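(* Let $g\in C^2([0,\infty))$ be a real-valued function such that the following conditions hold: (i) $g'(0)=0$, $g''(t)>0$ for all $t>0$, and $g''(0)\geq 0$ (the case $g''(0)=0$ being allowed); (ii) there are constants $m,M>0$ such that $m(t-1)\leq g(t)\leq M(t+1)$ for all $t\in[0,\infty)$; (iii) $\limsup_{t\to\infty}\left[g''(t)\,t\,\ln^2(t)\right]<\infty$. Let $u\in C^2(\mathbb{R}^2)$ be a real-valued entire solution of $$\operatorname{div}\left(\frac{g'(|\nabla u|)}{|\nabla u|}\nabla u\right)=0\quad\text{on }\mathbb{R}^2,$$ and suppose that there is a finite constant $K$ such that $$\ln\bigl(1+|\nabla u(x)|\bigr)\,|\partial_t u(x)|\leq K\bigl(1+|\nabla u(x)|\bigr)\quad\text{for all }x\in\mathbb{R}^2\setminus\{0\},$$ where $\partial_t u$ denotes the tangential derivative $\partial_t u(x):=\nabla u(x)\cdot\frac{x^\perp}{|x|}$ with $x^\perp:=(-x_2,x_1)$. Then $u$ is an affine function.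
   Context: Derivatives of $g$ at $t=0$ are one-sided. The vector field $a(p):=\frac{g'(|p|)}{|p|}p$, $p\in\mathbb{R}^2$, is understood to take the value $a(0)=0$ at $p=0$ (using $g'(0)=0$); equivalently $a=\nabla f$ with $f(p):=g(|p|)$. It is of class $C^1(\mathbb{R}^2,\mathbb{R}^2)$, so the equation $\operatorname{div}(a(\nabla u))=0$ is meant in the classical pointwise sense. ''Entire'' means defined on all of $\mathbb{R}^2$. The subscript $t$ in $\partial_t u$ stands for ''tangential'' and is unrelated to the variable $t$ of $g$; $\ln^2(t)=(\ln t)^2$. *)

(* Defs.v *)
From Stdlib Require Import Reals.
From Coquelicot Require Import Coquelicot.

Open Scope R_scope.

Definition nonneg (t : R) : Prop := 0 <= t.

(* [g] is of class C^2 on [0,oo), with derivatives [g'] and [g''] there.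
   [D_in] takes difference quotients inside the half-line only, so it is the
   ordinary derivative at t > 0 and the one-sided one at t = 0.  The values of
   [g'] and [g''] on [0,oo) are determined by [g]; values at negative
   arguments play no role. *)
Definition C2_halfline (g g' g'' : R -> R) : Prop :=
  (forall t, nonneg t -> D_in g g' nonneg t) /\
  (forall t, nonneg t -> D_in g' g'' nonneg t) /\
  continuous_on nonneg g''.

(* limsup_{t -> +oo} h(t) = inf_T sup_{t >= T} h(t), in the extended reals. *)
Definition LimSup_p_infty (h : R -> R) : Rbar :=
  Rbar_glb (fun s : Rbar =>
    exists T : R, s = Lub_Rbar (fun y : R => exists t : R, T <= t /\ y = h t)).

Definition C2_plane (u : R -> R -> R) : Prop :=
  forall x1 x2 : R, ex_diff_n u 2 x1 x2.

Definition dot (p q : R * R) : R := fst p * fst q + snd p * snd q.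

Definition euclid (p : R * R) : R := sqrt (dot p p).

Definition scale (c : R) (p : R * R) : R * R := (c * fst p, c * snd p).

Definition perp (p : R * R) : R * R := (- snd p, fst p).

Definition gradient (u : R -> R -> R) (x1 x2 : R) : R * R :=
  (Derive (fun s => u s x2) x1, Derive (fun s => u x1 s) x2).

Definition divergence (V : R -> R -> R * R) (x1 x2 : R) : R :=
  Derive (fun s => fst (V s x2)) x1 + Derive (fun s => snd (V x1 s)) x2.

(* a(p) = (g'(|p|) / |p|) p.  At p = 0 the quotient has a meaningless value,
   but it multiplies the zero vector, so that a(0) = 0. *)
Definition flux (g' : R -> R) (p : R * R) : R * R :=
  scale (g' (euclid p) / euclid p) p.

(* [Derive] is total, but when g' is C^1 on [0,oo) with g'(0) = 0 and u is C^2,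
   the field a(grad u) is C^1, so the partial derivatives below exist. *)
Definition entire_solution (g' : R -> R) (u : R -> R -> R) : Prop :=
  forall x1 x2 : R,
    divergence (fun y1 y2 => flux g' (gradient u y1 y2)) x1 x2 = 0.

Definition tangential_derivative (u : R -> R -> R) (x1 x2 : R) : R :=
  dot (gradient u x1 x2) (scale (/ euclid (x1, x2)) (perp (x1, x2))).

Definition affine (u : R -> R -> R) : Prop :=
  exists a b c : R, forall x1 x2 : R, u x1 x2 = a * x1 + b * x2 + c.

(* Main.v *)
(* Write [v = grad u], [t = |v|], and let [theta] be the direction of [v].  The equation
   expresses [det D^2 u] as minus a positive definite form in two entries of the
   Hessian, so that [det D^2 u <= 0].  For a bounded increasing function [P] of [t], let
   [E r] be minus the integral of [P dtheta] along the circle of radius [r].  By Stokes,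
   [E' r] is the integral of [- (P' / t) det D^2 u] over the circle.  With
   [P = k g'], where [k'] decays like [1 / (t (ln t)^2)], the tangential bound gives
   [E^2 <= C r E'] by the Cauchy-Schwarz inequality; as [1 / r] is not integrable at
   infinity, this forces [E = 0].  Hence [D^2 u = 0] wherever [grad u] is nonzero, so
   [|grad u|] is constant and [u] is affine.

   In terms of [s = t^2] we take [k = s * weight s], so that
   [P dtheta = weight s * g' t * (v1 dv2 - v2 dv1)] is regular at [t = 0]. *)
Require Import Defs.
From Stdlib Require Import Reals Lra Psatz.
From Coquelicot Require Import Coquelicot.

Open Scope R_scope.

(** * Circulation of C^1 maps along circles *)

(* [ring] does not see through Coquelicot's canonical structures on [R]. *)
Ltac ring_R :=
  intros; unfold minus, plus, opp, scal, mult; simpl;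
  unfold mult; simpl;
  match goal with |- ?a = ?b => change (a = b :> R) end; ring.

Lemma continuity_2d_pt_section (f : R -> R -> R) (x y : R) :
  continuity_2d_pt f x y -> continuous (f x) y.
Proof.
intros H. apply continuity_pt_filterlim. intros eps Heps.
destruct (H (mkposreal eps Heps)) as [d Hd].
exists d. split; [apply cond_pos|].
intros z [_ Hz]. apply Hd; [|exact Hz].
rewrite Rminus_diag, Rabs_R0. apply cond_pos.
Qed.

Lemma continuous_bounded (f : R -> R) (a b : R) :
  a <= b -> (forall x, a <= x <= b -> continuous f x) ->
  exists B, 0 <= B /\ forall x, a <= x <= b -> Rabs (f x) <= B.
Proof.
intros Hab Hf.
destruct (continuity_ab_maj (fun x => Rabs (f x)) a b Hab) as [m [Hm _]].
- intros c Hc. apply continuity_pt_filterlim.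
  apply (continuous_comp f Rabs); [now apply Hf|apply continuous_Rabs].
- exists (Rabs (f m)). split; [apply Rabs_pos|exact Hm].
Qed.

(** [C] is merely continuous, so the integrand need not be differentiable in [s]. The factor
    [A s y - A r y] vanishes at [s = r], however, so its difference quotient times [C s y] converges
    to [Ar r y * C r y], uniformly in [y] by uniform continuity on a compact set. *)
Lemma is_derive_RInt_increment (A Ar C : R -> R -> R) (a b r : R) :
  a <= b ->
  (forall s y, is_derive (fun s => A s y) s (Ar s y)) ->
  (forall s y, continuous (A s) y) ->
  (forall s y, continuity_2d_pt Ar s y) ->
  (forall s y, continuity_2d_pt C s y) ->
  is_derive (fun s => RInt (fun y => (A s y - A r y) * C s y) a b) r
    (RInt (fun y => Ar r y * C r y) a b).
Proof.
intros Hab HA HAc HAr HC.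
assert (cAr := fun s y => continuity_2d_pt_section Ar s y (HAr s y)).
assert (cC := fun s y => continuity_2d_pt_section C s y (HC s y)).
assert (I1 : forall s, ex_RInt (fun y => (A s y - A r y) * C s y) a b).
{ intros s. apply (ex_RInt_continuous (V := R_CompleteNormedModule)).
  intros y _. apply (continuous_mult (K := R_AbsRing)); [|apply cC].
  apply (continuous_minus (V := R_NormedModule)); apply HAc. }
assert (I2 : ex_RInt (fun y => Ar r y * C r y) a b).
{ apply (ex_RInt_continuous (V := R_CompleteNormedModule)).
  intros y _. apply (continuous_mult (K := R_AbsRing)); [apply cAr|apply cC]. }
destruct (continuous_bounded (Ar r) a b Hab (fun y _ => cAr r y)) as [B1 [HB1 B1P]].
destruct (continuous_bounded (C r) a b Hab (fun y _ => cC r y)) as [B2 [HB2 B2P]].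
apply is_derive_Reals. intros eps Heps.
(* The final error bound is [(b - a) * eta * (B1 + B2 + 1)]; the extra 1 in [b - a + 1] makes it
   strictly smaller than [eta * den], hence than [eps]. *)
set (den := (b - a + 1) * (B1 + B2 + 1)).
assert (Hden : 0 < den) by (unfold den; nra).
assert (Heta : 0 < Rmin 1 (eps / den)).
{ apply Rmin_pos; [lra|]. now apply Rdiv_lt_0_compat. }
set (eta := mkposreal _ Heta).
destruct (uniform_continuity_2d_1d' Ar a b r (fun y _ => HAr r y) eta) as [d1 Hd1].
destruct (uniform_continuity_2d_1d' C a b r (fun y _ => HC r y) eta) as [d2 Hd2].
assert (Hd : 0 < Rmin d1 d2) by (apply Rmin_pos; apply cond_pos).
exists (mkposreal _ Hd). intros h Hh Hhd. simpl in Hhd.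
assert (Hh1 := Rlt_le_trans _ _ _ Hhd (Rmin_l _ _)).
assert (Hh2 := Rlt_le_trans _ _ _ Hhd (Rmin_r _ _)).
assert (E0 : RInt (fun y => (A r y - A r y) * C r y) a b = 0 :> R).
{ rewrite (RInt_ext _ (fun _ => 0)).
  - rewrite RInt_const. apply (scal_zero_r (V := R_NormedModule)).
  - intros y _. simpl. ring. }
rewrite E0, Rminus_0_r.
assert (I1' : ex_RInt (fun y => / h * ((A (r + h) y - A r y) * C (r + h) y)) a b).
{ apply (ex_RInt_scal (V := R_NormedModule) _ a b (/ h)). apply I1. }
replace (RInt (fun y => (A (r + h) y - A r y) * C (r + h) y) a b / h)
  with (RInt (fun y => / h * ((A (r + h) y - A r y) * C (r + h) y)) a b).
2:{ rewrite (RInt_scal (V := R_CompleteNormedModule) _ a b (/ h)) by apply I1.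
    unfold scal; simpl; unfold mult; simpl. field. exact Hh. }
rewrite <- (RInt_minus (V := R_CompleteNormedModule)) by assumption.
apply Rle_lt_trans with ((b - a) * (eta * (B1 + B2 + 1))).
- apply abs_RInt_le_const; [exact Hab| |].
  + now apply (ex_RInt_minus (V := R_NormedModule)).
  + intros y Hy. unfold minus, plus, opp; simpl.
    (* For each [y] the mean value theorem turns the increment of [A] into [Ar c y * h], with [c]
       depending on [y] but within [Rabs h] of [r]. *)
    destruct (MVT_cor4 (fun s => A s y) (fun s => Ar s y) r (Rabs h)
                (fun c _ => HA c y) (r + h)) as [c [Hc Hcr]].
    { replace (r + h - r) with h by ring. lra. }
    replace (r + h - r) with h in Hc, Hcr by ring.
    rewrite Hc.
    replace (/ h * (Ar c y * h * C (r + h) y) + - (Ar r y * C r y))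
      with ((Ar c y - Ar r y) * C (r + h) y + Ar r y * (C (r + h) y - C r y))
      by (field; exact Hh).
    assert (K1 : Rabs (Ar c y - Ar r y) < eta).
    { apply Hd1; try assumption; try (rewrite Rminus_diag, Rabs_R0; apply cond_pos).
      - generalize (cond_pos d1); lra.
      - apply Rabs_le_between'. lra. }
    assert (K2 : Rabs (C (r + h) y - C r y) < eta).
    { apply Hd2; try assumption; try (rewrite Rminus_diag, Rabs_R0; apply cond_pos).
      - generalize (cond_pos d2); lra.
      - apply Rabs_le_between'. replace (r + h - r) with h by ring. lra. }
    assert (K3 : eta <= 1) by apply Rmin_l.
    assert (K4 : Rabs (C (r + h) y) <= B2 + 1).
    { replace (C (r + h) y) with (C r y + (C (r + h) y - C r y)) by ring.
      eapply Rle_trans; [apply Rabs_triang|]. generalize (B2P y Hy); lra. }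
    eapply Rle_trans; [apply Rabs_triang|]. rewrite !Rabs_mult.
    assert (K5 := B1P y Hy).
    assert (K6 := Rabs_pos (C r y)).
    assert (Rabs (Ar c y - Ar r y) * Rabs (C (r + h) y) <= eta * (B2 + 1))
      by (apply Rmult_le_compat; try apply Rabs_pos; lra).
    assert (Rabs (Ar r y) * Rabs (C (r + h) y - C r y) <= B1 * eta)
      by (apply Rmult_le_compat; try apply Rabs_pos; lra).
    change (Rmin 1 (eps / den)) with (pos eta). lra.
- assert (K : eta * den <= eps).
  { apply Rle_trans with (eps / den * den).
    - apply Rmult_le_compat_r; [lra|apply Rmin_r].
    - right; field; lra. }
  unfold den in K. assert (0 < eta * (B1 + B2 + 1)) by (apply Rmult_lt_0_compat; [exact Heta|lra]).
  nra.
Qed.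

Lemma continuity_2d_pt_comp2 (f p q : R -> R -> R) (x y : R) :
  continuity_2d_pt f (p x y) (q x y) ->
  continuity_2d_pt p x y -> continuity_2d_pt q x y ->
  continuity_2d_pt (fun x y => f (p x y) (q x y)) x y.
Proof.
intros Hf Hp Hq eps. destruct (Hf eps) as [d Hd].
generalize (locally_2d_and _ _ _ _ (Hp d) (Hq d)).
apply locally_2d_impl, locally_2d_forall.
intros u v [H1 H2]. now apply Hd.
Qed.

(** The partial derivatives are arguments, so that the symmetry of a Hessian can be expressed by
    using one function [b] in both [C1_plane v1 a b] and [C1_plane v2 b c]. *)
Definition C1_plane (f fx fy : R -> R -> R) : Prop :=
  (forall x y, is_derive (fun z => f z y) x (fx x y)) /\
  (forall x y, is_derive (f x) y (fy x y)) /\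
  (forall x y, continuity_2d_pt fx x y) /\
  (forall x y, continuity_2d_pt fy x y).

Lemma C1_plane_differentiable (f fx fy : R -> R -> R) (x y : R) :
  C1_plane f fx fy -> differentiable_pt_lim f x y (fx x y) (fy x y).
Proof.
intros (Hx & Hy & Cx & Cy).
apply filterdiff_differentiable_pt_lim.
apply (is_derive_filterdiff f x y fx (fy x y)).
- apply filter_forall. intros; apply Hx.
- apply Hy.
- apply continuity_2d_pt_filterlim, Cx.
Qed.

Lemma C1_plane_continuity (f fx fy : R -> R -> R) (x y : R) :
  C1_plane f fx fy -> continuity_2d_pt f x y.
Proof.
intros H. apply differentiable_continuity_pt.
exists (fx x y), (fy x y). now apply C1_plane_differentiable.
Qed.

Lemma C1_plane_curve (f fx fy : R -> R -> R) (p q : R -> R) (t p' q' : R) :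
  C1_plane f fx fy -> is_derive p t p' -> is_derive q t q' ->
  is_derive (fun t => f (p t) (q t)) t (fx (p t) (q t) * p' + fy (p t) (q t) * q').
Proof.
intros Hf Hp Hq. apply is_derive_Reals, derivable_pt_lim_comp_2d.
- now apply C1_plane_differentiable.
- now apply is_derive_Reals.
- now apply is_derive_Reals.
Qed.

Lemma C1_plane_mult (f fx fy h hx hy : R -> R -> R) :
  C1_plane f fx fy -> C1_plane h hx hy ->
  C1_plane (fun x y => f x y * h x y)
    (fun x y => fx x y * h x y + f x y * hx x y)
    (fun x y => fy x y * h x y + f x y * hy x y).
Proof.
intros Hf Hh.
assert (Cf := fun x y => C1_plane_continuity f fx fy x y Hf).
assert (Ch := fun x y => C1_plane_continuity h hx hy x y Hh).
destruct Hf as (fX & fY & cfx & cfy), Hh as (hX & hY & chx & chy).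
split; [|split; [|split]]; intros x y.
- apply (is_derive_mult (fun z => f z y) (fun z => h z y)); auto. intros; apply Rmult_comm.
- apply (is_derive_mult (f x) (h x)); auto. intros; apply Rmult_comm.
- apply continuity_2d_pt_plus; apply continuity_2d_pt_mult; auto.
- apply continuity_2d_pt_plus; apply continuity_2d_pt_mult; auto.
Qed.

Lemma C1_plane_plus (f fx fy h hx hy : R -> R -> R) :
  C1_plane f fx fy -> C1_plane h hx hy ->
  C1_plane (fun x y => f x y + h x y)
    (fun x y => fx x y + hx x y) (fun x y => fy x y + hy x y).
Proof.
intros (fX & fY & cfx & cfy) (hX & hY & chx & chy).
split; [|split; [|split]]; intros x y.
- now apply (is_derive_plus (V := R_NormedModule) (fun z => f z y) (fun z => h z y)).
- now apply (is_derive_plus (V := R_NormedModule) (f x) (h x)).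
- now apply continuity_2d_pt_plus.
- now apply continuity_2d_pt_plus.
Qed.

Lemma polar_continuity (f : R -> R -> R) (r y : R) :
  (forall x y, continuity_2d_pt f x y) ->
  continuity_2d_pt (fun r y => f (r * cos y) (r * sin y)) r y.
Proof.
intros Hf. apply (continuity_2d_pt_comp2 f); auto.
- apply continuity_2d_pt_mult; [apply continuity_2d_pt_id1|].
  apply (continuity_1d_2d_pt_comp cos (fun _ y => y));
    [apply continuity_cos|apply continuity_2d_pt_id2].
- apply continuity_2d_pt_mult; [apply continuity_2d_pt_id1|].
  apply (continuity_1d_2d_pt_comp sin (fun _ y => y));
    [apply continuity_sin|apply continuity_2d_pt_id2].
Qed.

Lemma C1_plane_polar (f fx fy : R -> R -> R) :
  C1_plane f fx fy ->
  C1_plane (fun r y => f (r * cos y) (r * sin y))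
    (fun r y => fx (r * cos y) (r * sin y) * cos y + fy (r * cos y) (r * sin y) * sin y)
    (fun r y => fx (r * cos y) (r * sin y) * (- r * sin y)
              + fy (r * cos y) (r * sin y) * (r * cos y)).
Proof.
intros Hf. assert (Hf' := Hf). destruct Hf' as (_ & _ & Cx & Cy).
assert (Cc : forall r y, continuity_2d_pt (fun _ y => cos y) r y).
{ intros. apply (continuity_1d_2d_pt_comp cos (fun _ y => y));
    [apply continuity_cos|apply continuity_2d_pt_id2]. }
assert (Cs : forall r y, continuity_2d_pt (fun _ y => sin y) r y).
{ intros. apply (continuity_1d_2d_pt_comp sin (fun _ y => y));
    [apply continuity_sin|apply continuity_2d_pt_id2]. }
assert (Cr := continuity_2d_pt_id1).
assert (Px := fun r y => polar_continuity fx r y Cx).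
assert (Py := fun r y => polar_continuity fy r y Cy).
split; [|split; [|split]]; intros r y.
- apply (C1_plane_curve f fx fy (fun r => r * cos y) (fun r => r * sin y)); trivial;
    auto_derive; trivial; ring.
- apply (C1_plane_curve f fx fy (fun y => r * cos y) (fun y => r * sin y)); trivial;
    auto_derive; trivial; ring.
- apply continuity_2d_pt_plus; apply continuity_2d_pt_mult; auto.
- apply continuity_2d_pt_plus; repeat apply continuity_2d_pt_mult; auto.
  now apply continuity_2d_pt_opp.
Qed.

(* Only first derivatives of [A] and [V] are available, so the increment of
   the integral is split as [A(s) - A(r)] against [Vy(s)] plus [A(r)] against
   [Vy(s) - Vy(r)], and the [y]-derivative is moved off [V] in the second part. *)
Lemma is_derive_circulation (A Ar Ay V Vr Vy : R -> R -> R) (T r : R) :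
  0 <= T ->
  C1_plane A Ar Ay -> C1_plane V Vr Vy ->
  (forall s, A s T = A s 0) -> (forall s, V s T = V s 0) ->
  is_derive (fun s => RInt (fun y => A s y * Vy s y) 0 T) r
    (RInt (fun y => Ar r y * Vy r y - Ay r y * Vr r y) 0 T).
Proof.
intros HT (HAr & HAy & cAr & cAy) (HVr & HVy & cVr & cVy) PA PV.
assert (cA : forall s y, continuous (A s) y).
{ intros. apply (ex_derive_continuous (A s)). eexists; apply HAy. }
assert (cV : forall s y, continuous (V s) y).
{ intros. apply (ex_derive_continuous (V s)). eexists; apply HVy. }
assert (sAr := fun s y => continuity_2d_pt_section _ s y (cAr s y)).
assert (sAy := fun s y => continuity_2d_pt_section _ s y (cAy s y)).
assert (sVr := fun s y => continuity_2d_pt_section _ s y (cVr s y)).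
assert (sVy := fun s y => continuity_2d_pt_section _ s y (cVy s y)).
assert (I : forall f g : R -> R, (forall y, continuous f y) -> (forall y, continuous g y) ->
  ex_RInt (fun y => f y * g y) 0 T).
{ intros f g Hf Hg. apply (ex_RInt_continuous (V := R_CompleteNormedModule)).
  intros y _. apply (continuous_mult (K := R_AbsRing)); auto. }
(* Integration by parts over a full period: the boundary terms cancel because [A] and [V] agree at
   [0] and [T]. *)
assert (parts : forall s,
  RInt (fun y => A r y * Vy s y) 0 T = - RInt (fun y => Ay r y * V s y) 0 T).
{ intros s.
  assert (E : RInt (fun y => plus (Ay r y * V s y) (A r y * Vy s y)) 0 T = 0).
  { apply is_RInt_unique.
    replace 0 with (minus (A r T * V s T) (A r 0 * V s 0)) at 2.
    2:{ rewrite PA, PV. unfold minus, plus, opp; simpl. ring. }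
    apply (is_RInt_derive (V := R_CompleteNormedModule) (fun y => A r y * V s y)).
    - intros y _. apply (is_derive_mult (A r) (V s)); auto. intros; apply Rmult_comm.
    - intros y _. apply (continuous_plus (V := R_NormedModule));
        apply (continuous_mult (K := R_AbsRing)); auto. }
  rewrite (RInt_plus (V := R_CompleteNormedModule)) in E by (apply I; auto).
  unfold plus in E; simpl in E. lra. }
apply is_derive_ext with (fun s =>
  RInt (fun y => (A s y - A r y) * Vy s y) 0 T
  - RInt (fun y => (V s y - V r y) * Ay r y) 0 T
  + RInt (fun y => A r y * Vy r y) 0 T).
{ intros s.
  rewrite (RInt_ext (fun y => (A s y - A r y) * Vy s y)
             (fun y => minus (A s y * Vy s y) (A r y * Vy s y)))
    by ring_R.
  rewrite (RInt_ext (fun y => (V s y - V r y) * Ay r y)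
             (fun y => minus (Ay r y * V s y) (Ay r y * V r y)))
    by ring_R.
  rewrite !(RInt_minus (V := R_CompleteNormedModule)) by (apply I; auto).
  rewrite !parts. ring_R. }
replace (RInt (fun y => Ar r y * Vy r y - Ay r y * Vr r y) 0 T)
  with (RInt (fun y => Ar r y * Vy r y) 0 T - RInt (fun y => Vr r y * Ay r y) 0 T + 0).
2:{ rewrite (RInt_ext (fun y => Vr r y * Ay r y) (fun y => Ay r y * Vr r y))
      by ring_R.
    symmetry. rewrite Rplus_0_r.
    apply (RInt_minus (V := R_CompleteNormedModule) (fun y => Ar r y * Vy r y)
      (fun y => Ay r y * Vr r y)); apply I; auto. }
apply (is_derive_plus (V := R_NormedModule)); [|apply (is_derive_const (V := R_NormedModule))].
apply (is_derive_minus (V := R_NormedModule)).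
- now apply is_derive_RInt_increment.
- apply (is_derive_RInt_increment V Vr (fun _ y => Ay r y)); auto.
  intros s y. apply (continuity_1d_2d_pt_comp (Ay r) (fun _ y => y)).
  + apply continuity_pt_filterlim, sAy.
  + apply continuity_2d_pt_id2.
Qed.

(* If [E r0 > 0], then [1/E + ln r / C] is nonincreasing after [r0], although
   [ln] is unbounded. *)
Lemma sqr_le_derive_vanish (E E' : R -> R) (C : R) :
  0 < C ->
  (forall r, is_derive E r (E' r)) ->
  E 0 = 0 ->
  (forall r, 0 < r -> 0 <= E' r) ->
  (forall r, 0 < r -> E r ^ 2 <= C * r * E' r) ->
  forall r, 0 <= r -> E r = 0.
Proof.
intros HC HE E0 Hpos Hsqr.
assert (mono : forall x y, 0 <= x -> x <= y -> E x <= E y).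
{ intros x y Hx Hxy. destruct (Req_dec x y) as [->|Hne]; [lra|].
  destruct (MVT_gen E x y E') as [c [Hc Hd]].
  - intros; apply HE.
  - intros z _. apply continuity_pt_filterlim, (ex_derive_continuous E). eexists; apply HE.
  - rewrite Rmin_left, Rmax_right in Hc by lra.
    (* The point [c] may be an endpoint, and the sign of [E'] is unknown at 0. In that case [x = 0],
       and a mean value theorem with a strictly interior point is applied instead. *)
    destruct (Req_dec c 0) as [->|Hc0].
    + assert (x = 0) by lra. subst x. rewrite E0 in *.
      destruct (MVT_cor2 E E' 0 y) as [c' [Hc' Hb]]; [lra| |].
      * intros z _. apply is_derive_Reals, HE.
      * assert (0 <= E' c') by (apply Hpos; lra). nra.
    + assert (0 <= E' c) by (apply Hpos; lra). nra. }
intros r Hr. destruct (Rle_lt_or_eq_dec 0 (E r)) as [Hgt|]; [| |congruence].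
{ rewrite <- E0. apply mono; lra. }
exfalso.
assert (Hr0 : 0 < r) by (destruct Hr as [|<-]; [assumption|lra]).
(* Chosen so that [ln y / C] is at least [/ E r + ln r / C]; the monotonicity of [/ E + ln / C]
   would then give [/ E y <= 0]. The bound [r + 1] ensures [r < y]. *)
set (y := Rmax (r + 1) (exp (C * (/ E r + ln r / C)))).
assert (Hy : r < y) by (unfold y; generalize (Rmax_l (r + 1) (exp (C * (/ E r + ln r / C)))); lra).
destruct (MVT_cor2 (fun z => / E z + ln z / C) (fun z => - E' z / E z ^ 2 + / z / C) r y Hy)
  as [c [Hc Hcr]].
- intros z Hz. apply is_derive_Reals.
  assert (0 < E z) by (apply Rlt_le_trans with (E r); [assumption|apply mono; lra]).
  auto_derive.
  + repeat split; try lra. eexists; apply HE.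
  + replace (Derive (fun x => E x) z) with (E' z)
      by (symmetry; apply is_derive_unique, HE).
    field. repeat split; lra.
- assert (Ec : 0 < E c) by (apply Rlt_le_trans with (E r); [assumption|apply mono; lra]).
  assert (Ey : 0 < E y) by (apply Rlt_le_trans with (E r); [assumption|apply mono; lra]).
  assert (- E' c / E c ^ 2 + / c / C <= 0).
  { assert (K := Hsqr c ltac:(lra)).
    replace (- E' c / E c ^ 2 + / c / C) with (- ((C * c * E' c - E c ^ 2) / (C * c * E c ^ 2)))
      by (field; lra).
    assert (0 <= (C * c * E' c - E c ^ 2) / (C * c * E c ^ 2)); [|lra].
    apply Rdiv_le_0_compat; [lra|].
    apply Rmult_lt_0_compat; [apply Rmult_lt_0_compat; lra|now apply pow_lt]. }
  assert (K2 : C * (/ E r + ln r / C) <= ln y).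
  { rewrite <- (ln_exp (C * (/ E r + ln r / C))). apply ln_le; [apply exp_pos|apply Rmax_r]. }
  assert (K3 : / E r + ln r / C <= ln y / C).
  { apply Rmult_le_reg_l with C; [exact HC|].
    replace (C * (ln y / C)) with (ln y) by (field; lra). exact K2. }
  assert (0 < / E y) by now apply Rinv_0_lt_compat.
  nra.
Qed.

(** * The weight and the pointwise estimate *)

(** The constant 2 gives [/ logw s <= / 2] for [s >= 0], hence [damp s > 0], and makes the remainder
    [2 * logw s ^ 2 - 2 * logw s - 1] in [weight_growth] nonnegative. *)
Definition logw (s : R) : R := 2 + ln (1 + s).
Definition damp (s : R) : R := (1 - / logw s) / (1 + s) ^ 2.
Definition damp' (s : R) : R :=
  / ((1 + s) ^ 3 * logw s ^ 2) - 2 * (1 - / logw s) / (1 + s) ^ 3.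
(** Thus [s * weight s = (s / (1 + s)) ^ 2 * (1 - / logw s)], which tends to 1 at infinity. *)
Definition weight (s : R) : R := s * damp s.
Definition weight' (s : R) : R := damp s + s * damp' s.

Lemma logw_ge (s : R) : 0 <= s -> 2 <= logw s.
Proof.
intros Hs. unfold logw. assert (ln 1 <= ln (1 + s)) by (apply ln_le; lra).
rewrite ln_1 in H. lra.
Qed.

Lemma damp_derive (s : R) : 0 <= s -> is_derive damp s (damp' s).
Proof.
intros Hs. assert (HL := logw_ge s Hs).
unfold damp, damp', logw in *.
auto_derive.
- repeat split; try lra. apply Rgt_not_eq, Rmult_lt_0_compat; lra.
- field. lra.
Qed.

Lemma damp'_continuous (s : R) : 0 <= s -> continuous damp' s.
Proof.
intros Hs. assert (HL := logw_ge s Hs).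
apply (ex_derive_continuous damp'). unfold damp', logw in *.
auto_derive.
assert (0 < (1 + s) ^ 3) by (apply pow_lt; lra).
assert (0 < (2 + ln (1 + s)) ^ 2) by (apply pow_lt; lra).
repeat split; try lra; apply Rgt_not_eq; try apply Rmult_lt_0_compat; simpl in *; lra.
Qed.

Lemma weight_derive (s : R) : 0 <= s -> is_derive weight s (weight' s).
Proof.
intros Hs. unfold weight.
evar_last.
- apply (is_derive_mult (fun s => s) damp); [apply is_derive_id|now apply damp_derive|].
  intros; apply Rmult_comm.
- unfold weight', plus, mult, one; simpl. ring.
Qed.

Lemma damp_bounds (s : R) : 0 <= s -> 0 < damp s <= / (1 + s) ^ 2.
Proof.
intros Hs. assert (HL := logw_ge s Hs). unfold damp.
assert (K : 0 < (1 + s) ^ 2) by (apply pow_lt; lra).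
assert (0 < / logw s) by (apply Rinv_0_lt_compat; lra).
assert (/ logw s <= / 2) by (apply Rinv_le_contravar; lra).
split.
- apply Rdiv_lt_0_compat; lra.
- unfold Rdiv. rewrite <- (Rmult_1_l (/ (1 + s) ^ 2)) at 2.
  apply Rmult_le_compat_r; [left; now apply Rinv_0_lt_compat|lra].
Qed.

(* The left-hand side is the derivative of the bounded increasing function
   [s * weight s]; the right-hand side has the order [1 / (s (ln s)^2)]
   at infinity. *)
Lemma weight_growth (s : R) : 0 <= s ->
  s / ((1 + s) ^ 2 * logw s ^ 2) <= weight s + s * weight' s.
Proof.
intros Hs. assert (HL := logw_ge s Hs). unfold weight, weight', damp, damp'.
replace (s * ((1 - / logw s) / (1 + s) ^ 2) +
  s * ((1 - / logw s) / (1 + s) ^ 2 +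
    s * (/ ((1 + s) ^ 3 * logw s ^ 2) - 2 * (1 - / logw s) / (1 + s) ^ 3)))
  with (s / ((1 + s) ^ 2 * logw s ^ 2)
        + s * (2 * logw s ^ 2 - 2 * logw s - 1) / ((1 + s) ^ 3 * logw s ^ 2))
  by (field; lra).
assert (0 <= s * (2 * logw s ^ 2 - 2 * logw s - 1) / ((1 + s) ^ 3 * logw s ^ 2)); [|lra].
apply Rdiv_le_0_compat.
- apply Rmult_le_pos; nra.
- apply Rmult_lt_0_compat; apply pow_lt; lra.
Qed.

(** Since [1 + t^2 <= (1 + t)^2], [logw (t^2)] is at most [2 + 2 * ln (1 + t)]. The logarithm is
    absorbed by the tangential hypothesis and the constant 2 by [Rabs w <= t]; squaring uses
    [(1 + t)^2 <= 2 * (1 + t^2)]. *)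
Lemma tangential_logw (K t w : R) :
  0 <= K -> 0 <= t -> Rabs w <= t -> ln (1 + t) * Rabs w <= K * (1 + t) ->
  (w * logw (t ^ 2)) ^ 2 <= 8 * (1 + K) ^ 2 * (1 + t ^ 2).
Proof.
intros HK Ht Hw Hln.
assert (HL := logw_ge (t ^ 2) (pow2_ge_0 t)).
assert (Hlog : logw (t ^ 2) <= 2 + 2 * ln (1 + t)).
{ unfold logw. replace (2 * ln (1 + t)) with (ln ((1 + t) ^ 2)).
  - apply Rplus_le_compat_l, ln_le; nra.
  - simpl. rewrite Rmult_1_r, ln_mult by lra. ring. }
assert (H1 : Rabs w * logw (t ^ 2) <= 2 * (1 + K) * (1 + t)).
{ assert (H0 := Rabs_pos w).
  apply Rle_trans with (Rabs w * (2 + 2 * ln (1 + t))); [now apply Rmult_le_compat_l|nra]. }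
rewrite <- (pow2_abs (w * _)), Rabs_mult, (Rabs_pos_eq (logw _)) by lra.
assert (H2 : 0 <= Rabs w * logw (t ^ 2)) by (apply Rmult_le_pos; [apply Rabs_pos|lra]).
apply Rle_trans with ((2 * (1 + K) * (1 + t)) ^ 2); [now apply pow_incr|].
assert (0 <= (1 + K) ^ 2) by apply pow2_ge_0.
assert ((1 + t) ^ 2 <= 2 * (1 + t ^ 2)) by (generalize (pow2_ge_0 (t - 1)); lra).
rewrite !Rpow_mult_distr. apply Rle_trans with (2 ^ 2 * (1 + K) ^ 2 * (2 * (1 + t ^ 2))); [|right; ring].
apply Rmult_le_compat_l; [|assumption]. apply Rmult_le_pos; [lra|assumption].
Qed.

(* With [n = grad u / t] and [o] its rotation by a right angle, [X], [Y], [Z]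
   are the entries [(n,o)], [(o,o)], [(n,n)] of the Hessian [(a, b; b, c)] in
   that frame; the equation reads [t g2 Z + g1 Y = 0], so that
   [b^2 - a c = X^2 + g1 Y^2 / (t g2)]. *)
Lemma hessian_frame (a b c v1 v2 t g1 g2 : R) :
  0 < t -> 0 < g2 -> v1 ^ 2 + v2 ^ 2 = t ^ 2 ->
  t * g2 * (a * v1 ^ 2 + 2 * b * v1 * v2 + c * v2 ^ 2)
    + g1 * (a * v2 ^ 2 - 2 * b * v1 * v2 + c * v1 ^ 2) = 0 ->
  exists X Y,
    v1 * v2 * (c - a) + b * (v1 ^ 2 - v2 ^ 2) = t ^ 2 * X /\
    a * v2 ^ 2 - 2 * b * v1 * v2 + c * v1 ^ 2 = t ^ 2 * Y /\
    b ^ 2 - a * c = X ^ 2 + g1 / (t * g2) * Y ^ 2.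
Proof.
intros Ht Hg2 Hs Heq.
set (Z := (a * v1 ^ 2 + 2 * b * v1 * v2 + c * v2 ^ 2) / t ^ 2).
exists ((v1 * v2 * (c - a) + b * (v1 ^ 2 - v2 ^ 2)) / t ^ 2),
       ((a * v2 ^ 2 - 2 * b * v1 * v2 + c * v1 ^ 2) / t ^ 2).
assert (Ht2 : 0 < t ^ 2) by now apply pow_lt.
split; [field; lra|]. split; [field; lra|].
set (X := _ / t ^ 2). set (Y := _ / t ^ 2).
assert (HZ : Z = - (g1 / (t * g2)) * Y).
{ unfold Z, Y.
  replace (a * v1 ^ 2 + 2 * b * v1 * v2 + c * v2 ^ 2)
    with (- g1 * (a * v2 ^ 2 - 2 * b * v1 * v2 + c * v1 ^ 2) / (t * g2))
    by (field_simplify_eq; lra).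
  field. lra. }
(* The determinant is the same in the rotated frame: [X^2 - Z * Y = b^2 - a * c]. After
   multiplication by [t^4], written as [(v1^2 + v2^2)^2], this is a polynomial identity. *)
apply Rmult_eq_reg_l with (t ^ 2 * t ^ 2); [|nra].
transitivity (t ^ 2 * t ^ 2 * (X ^ 2 - Z * Y)); [|rewrite HZ; ring].
transitivity ((t ^ 2 * X) ^ 2 - (t ^ 2 * Z) * (t ^ 2 * Y)); [|ring].
unfold X, Y, Z. rewrite <- Hs at 1 2.
replace (t ^ 2 * ((v1 * v2 * (c - a) + b * (v1 ^ 2 - v2 ^ 2)) / t ^ 2))
  with (v1 * v2 * (c - a) + b * (v1 ^ 2 - v2 ^ 2)) by (field; lra).
replace (t ^ 2 * ((a * v1 ^ 2 + 2 * b * v1 * v2 + c * v2 ^ 2) / t ^ 2))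
  with (a * v1 ^ 2 + 2 * b * v1 * v2 + c * v2 ^ 2) by (field; lra).
replace (t ^ 2 * ((a * v2 ^ 2 - 2 * b * v1 * v2 + c * v1 ^ 2) / t ^ 2))
  with (a * v2 ^ 2 - 2 * b * v1 * v2 + c * v1 ^ 2) by (field; lra).
ring.
Qed.

(** With [w] and [z] the components of the gradient along and across the unit vector [e], the
    circulation integrand is [N * g1 * (w * X + z * Y)]. The [X] part is controlled by the
    logarithmic bound on [w] together with [weight_growth], the [Y] part by [z^2 <= t^2] and
    [N * t^2 <= 1]. *)
Lemma circulation_density_bound (a b c v1 v2 e1 e2 t g1 g2 G C0 : R) :
  let N := weight (t ^ 2) in
  let N' := weight' (t ^ 2) in
  0 < t -> 0 < g1 <= G -> 0 < g2 -> 0 <= C0 ->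
  v1 ^ 2 + v2 ^ 2 = t ^ 2 -> e1 ^ 2 + e2 ^ 2 = 1 ->
  ((e1 * v1 + e2 * v2) * logw (t ^ 2)) ^ 2 <= C0 * (1 + t ^ 2) ->
  t * g2 * (a * v1 ^ 2 + 2 * b * v1 * v2 + c * v2 ^ 2)
    + g1 * (a * v2 ^ 2 - 2 * b * v1 * v2 + c * v1 ^ 2) = 0 ->
  (N * g1 * (v1 * (b * e1 + c * e2) - v2 * (a * e1 + b * e2))) ^ 2
    <= 2 * G * (1 + C0)
       * ((2 * (N + t ^ 2 * N') * g1 + N * t * g2) * (b ^ 2 - a * c)).
Proof.
intros N N' Ht [Hg1 HG] Hg2 HC0 Hs He Hw Heq.
destruct (hessian_frame a b c v1 v2 t g1 g2 Ht Hg2 Hs Heq) as [X [Y [HX [HY HD]]]].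
set (w := e1 * v1 + e2 * v2) in *. set (z := e2 * v1 - e1 * v2).
assert (Ht2 : 0 < t ^ 2) by now apply pow_lt.
assert (HL := logw_ge (t ^ 2) (Rlt_le _ _ Ht2)).
assert (Hdamp := damp_bounds (t ^ 2) (Rlt_le _ _ Ht2)).
assert (Hk := weight_growth (t ^ 2) (Rlt_le _ _ Ht2)).
fold N N' in Hk. set (k := N + t ^ 2 * N') in *.
assert (HW : v1 * (b * e1 + c * e2) - v2 * (a * e1 + b * e2) = w * X + z * Y).
{ apply Rmult_eq_reg_l with (t ^ 2); [|lra].
  replace (t ^ 2 * (w * X + z * Y)) with (w * (t ^ 2 * X) + z * (t ^ 2 * Y)) by ring.
  rewrite <- HX, <- HY, <- Hs. unfold w, z. ring. }
assert (Hwz : z ^ 2 <= t ^ 2).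
{ replace (t ^ 2) with (w ^ 2 + z ^ 2).
  - generalize (pow2_ge_0 w); lra.
  - rewrite <- Hs, <- (Rmult_1_l (v1 ^ 2 + v2 ^ 2)), <- He. unfold w, z. ring. }
rewrite HW, HD.
assert (HN : 0 < N) by (unfold N, weight; apply Rmult_lt_0_compat; lra).
assert (Hinv : 0 < / (1 + t ^ 2)) by (apply Rinv_0_lt_compat; lra).
assert (HNle : N * (1 + t ^ 2) ^ 2 <= t ^ 2).
{ unfold N, weight. rewrite Rmult_assoc. rewrite <- (Rmult_1_r (t ^ 2)) at 4.
  apply Rmult_le_compat_l; [lra|].
  apply Rmult_le_reg_r with (/ (1 + t ^ 2) ^ 2).
  - apply Rinv_0_lt_compat, pow_lt; lra.
  - rewrite Rmult_assoc, Rinv_r, Rmult_1_r, Rmult_1_l; [lra|].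
    apply Rgt_not_eq, pow_lt; lra. }
assert (Hkpos : 0 < k).
{ apply Rlt_le_trans with (2 := Hk). apply Rdiv_lt_0_compat; [lra|].
  apply Rmult_lt_0_compat; apply pow_lt; lra. }
assert (HNt : N * t ^ 2 <= 1).
{ assert (N * t ^ 2 * (1 + t ^ 2) ^ 2 <= 1 * (1 + t ^ 2) ^ 2); [nra|].
  apply Rmult_le_reg_r with ((1 + t ^ 2) ^ 2); [apply pow_lt; lra|assumption]. }
(* This is where the tangential bound meets the weight: the factor [logw (t^2) ^ 2] gained from [w]
   is exactly the one lost in the lower bound for [k]. *)
assert (HNw : N ^ 2 * w ^ 2 <= C0 * k).
{ apply Rle_trans with (C0 * (t ^ 2 / ((1 + t ^ 2) ^ 2 * logw (t ^ 2) ^ 2)));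
    [|now apply Rmult_le_compat_l].
  assert (HM : 0 < (1 + t ^ 2) ^ 2 * logw (t ^ 2) ^ 2)
    by (apply Rmult_lt_0_compat; apply pow_lt; lra).
  apply Rmult_le_reg_r with ((1 + t ^ 2) ^ 2 * logw (t ^ 2) ^ 2); [exact HM|].
  replace (C0 * (t ^ 2 / ((1 + t ^ 2) ^ 2 * logw (t ^ 2) ^ 2)) *
    ((1 + t ^ 2) ^ 2 * logw (t ^ 2) ^ 2)) with (C0 * t ^ 2) by (field; lra).
  replace (N ^ 2 * w ^ 2 * ((1 + t ^ 2) ^ 2 * logw (t ^ 2) ^ 2))
    with (N * (N * (1 + t ^ 2) ^ 2) * (w * logw (t ^ 2)) ^ 2) by ring.
  apply Rle_trans with (N * t ^ 2 * (C0 * (1 + t ^ 2))).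
  - apply Rmult_le_compat; [| apply pow2_ge_0 | | exact Hw].
    + apply Rmult_le_pos; [lra|]. apply Rmult_le_pos; [lra|apply pow2_ge_0].
    + apply Rmult_le_compat_l; lra.
  - replace (N * t ^ 2 * (C0 * (1 + t ^ 2))) with (C0 * t ^ 2 * (N * (1 + t ^ 2))) by ring.
    rewrite <- (Rmult_1_r (C0 * t ^ 2)) at 2.
    apply Rmult_le_compat_l; [apply Rmult_le_pos; lra|].
    apply Rmult_le_reg_r with (1 + t ^ 2); [lra|]. nra. }
(* [d] is the coefficient of [Y^2] in [b^2 - a * c]. As [d * (t * g2) = g1], the term [N * t * g2]
   of the density yields [N * g1 * Y^2], in which [g2] has disappeared. *)
set (d := g1 / (t * g2)).
assert (Hd : 0 < d) by (apply Rdiv_lt_0_compat; [lra|now apply Rmult_lt_0_compat]).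
assert (Hdg : d * (t * g2) = g1) by (unfold d; field; lra).
clearbody d k N.
apply Rle_trans with (2 * g1 ^ 2 * (N ^ 2 * w ^ 2 * X ^ 2 + N ^ 2 * z ^ 2 * Y ^ 2)).
{ rewrite Rpow_mult_distr.
  generalize (Rmult_le_pos _ _ (pow2_ge_0 (N * g1)) (pow2_ge_0 (w * X - z * Y))). lra. }
assert (P1 : N ^ 2 * w ^ 2 * X ^ 2 <= C0 * k * X ^ 2)
  by (apply Rmult_le_compat_r; [apply pow2_ge_0|exact HNw]).
assert (P2 : N ^ 2 * z ^ 2 * Y ^ 2 <= N * Y ^ 2).
{ apply Rmult_le_compat_r; [apply pow2_ge_0|].
  apply Rle_trans with (N * (N * t ^ 2)); [|nra].
  replace (N ^ 2 * z ^ 2) with (N * (N * z ^ 2)) by ring.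
  apply Rmult_le_compat_l; [lra|]. apply Rmult_le_compat_l; lra. }
assert (HX2 := pow2_ge_0 X). assert (HY2 := pow2_ge_0 Y).
apply Rle_trans with (2 * g1 ^ 2 * (C0 * k * X ^ 2 + N * Y ^ 2)).
{ apply Rmult_le_compat_l; [generalize (pow2_ge_0 g1); lra|lra]. }
(* Only one of the two factors [g1] is bounded by [G]; the other is matched with the density. *)
apply Rle_trans with (2 * (G * g1) * (C0 * k * X ^ 2 + N * Y ^ 2)).
{ apply Rmult_le_compat_r.
  - apply Rplus_le_le_0_compat; apply Rmult_le_pos; nra.
  - nra. }
replace ((2 * k * g1 + N * t * g2) * (X ^ 2 + d * Y ^ 2))
  with (2 * k * g1 * X ^ 2 + N * (t * g2) * X ^ 2 + 2 * k * g1 * d * Y ^ 2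
        + N * (d * (t * g2)) * Y ^ 2) by ring.
rewrite Hdg.
assert (0 <= N * (t * g2) * X ^ 2) by (apply Rmult_le_pos; [repeat apply Rmult_le_pos; lra|assumption]).
assert (0 <= 2 * k * g1 * d * Y ^ 2) by (apply Rmult_le_pos; [repeat apply Rmult_le_pos; lra|assumption]).
assert (0 <= k * g1 * X ^ 2) by (apply Rmult_le_pos; [repeat apply Rmult_le_pos; lra|assumption]).
assert (0 <= N * g1 * Y ^ 2) by (apply Rmult_le_pos; [repeat apply Rmult_le_pos; lra|assumption]).
replace (2 * (G * g1) * (C0 * k * X ^ 2 + N * Y ^ 2))
  with (2 * G * (C0 * (k * g1 * X ^ 2) + N * g1 * Y ^ 2)) by ring.
rewrite (Rmult_assoc (2 * G)). apply Rmult_le_compat_l; [lra|].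
apply Rle_trans with ((1 + C0) * (k * g1 * X ^ 2 + N * g1 * Y ^ 2)).
- assert (0 <= C0 * (N * g1 * Y ^ 2)) by (apply Rmult_le_pos; lra). lra.
- apply Rmult_le_compat_l; lra.
Qed.

(** * Vanishing of the circulation *)

Lemma RInt_eq_0_nonneg (f : R -> R) (a b x : R) :
  (forall y, continuous f y) -> (forall y, 0 <= f y) ->
  RInt f a b = 0 -> a <= x < b -> f x = 0.
Proof.
intros Hc Hpos HI Hx.
destruct (Rle_lt_or_eq_dec 0 (f x) (Hpos x)) as [Hgt|]; [|congruence].
exfalso.
destruct (proj2 (continuity_pt_filterlim f x) (Hc x) (f x) Hgt) as [d [Hd Hnear]].
assert (ex : forall y z, ex_RInt f y z).
{ intros. apply (ex_RInt_continuous (V := R_CompleteNormedModule)). auto. }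
(* An interval to the right of [x] on which [f] stays positive; it is nondegenerate because
   [x < b]. *)
set (y := Rmin b (x + d / 2)).
assert (Hy : x < y) by (apply Rmin_glb_lt; lra).
assert (Hyb : y <= b) by apply Rmin_l.
assert (Hyd : y <= x + d / 2) by apply Rmin_r.
assert (K1 : 0 <= RInt f a x) by (apply RInt_ge_0; auto; lra).
assert (K2 : 0 <= RInt f y b) by (apply RInt_ge_0; auto; lra).
assert (K3 : 0 < RInt f x y).
{ apply RInt_gt_0; auto. intros z Hz.
  assert (K : Rabs (f z - f x) < f x).
  { apply Hnear. split.
    - split; [exact I|lra].
    - simpl. unfold Rdist. rewrite Rabs_pos_eq; lra. }
  apply Rabs_def2 in K. lra. }
assert (H1 := RInt_Chasles f a x b (ex _ _) (ex _ _)).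
assert (H2 := RInt_Chasles f x y b (ex _ _) (ex _ _)).
unfold plus in H1, H2; simpl in H1, H2. lra.
Qed.

Lemma polar_coordinates (x y : R) : (x, y) <> (0, 0) ->
  exists r p, 0 < r /\ 0 <= p < 2 * PI /\ x = r * cos p /\ y = r * sin p.
Proof.
intros Hxy.
assert (Hs : 0 < x ^ 2 + y ^ 2).
{ assert (H1 := pow2_ge_0 x). assert (H2 := pow2_ge_0 y).
  destruct (Req_dec x 0) as [->|Hx].
  - destruct (Req_dec y 0) as [->|Hy]; [now elim Hxy|].
    generalize (pow2_gt_0 y Hy); lra.
  - generalize (pow2_gt_0 x Hx); lra. }
set (r := sqrt (x ^ 2 + y ^ 2)).
assert (Hr : 0 < r) by now apply sqrt_lt_R0.
assert (Hr2 : r ^ 2 = x ^ 2 + y ^ 2) by (apply pow2_sqrt; lra).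
assert (Hxr : -1 <= x / r <= 1).
{ assert (- r <= x <= r) by (generalize (pow2_ge_0 y); split; nra).
  split.
  - apply Rmult_le_reg_r with r; [lra|]. unfold Rdiv. rewrite Rmult_assoc, Rinv_l; lra.
  - apply Rmult_le_reg_r with r; [lra|]. unfold Rdiv. rewrite Rmult_assoc, Rinv_l; lra. }
assert (Hsin : sin (acos (x / r)) = Rabs y / r).
{ rewrite sin_acos by assumption.
  replace (1 - (x / r)²) with ((Rabs y / r) ^ 2).
  - apply sqrt_pow2. apply Rdiv_le_0_compat; [apply Rabs_pos|assumption].
  - unfold Rsqr. replace ((Rabs y / r) ^ 2) with (Rabs y ^ 2 / r ^ 2) by (field; lra).
    rewrite pow2_abs. replace (y ^ 2) with (r ^ 2 - x ^ 2) by lra. field; lra. }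
assert (Hb := acos_bound (x / r)). assert (HPI := PI_RGT_0).
exists r. destruct (Rle_lt_dec 0 y) as [Hy|Hy].
- exists (acos (x / r)). repeat split; try lra.
  + rewrite cos_acos by assumption. field; lra.
  + rewrite Hsin, Rabs_pos_eq by assumption. field; lra.
- exists (2 * PI - acos (x / r)). rewrite cos_minus, sin_minus, cos_2PI, sin_2PI.
  rewrite cos_acos, Hsin, Rabs_left by assumption.
  repeat split; try lra; try (field; lra).
  (* For [y < 0] the angle must stay strictly below [2 * PI]; a zero arc cosine would force
     [y = 0]. *)
  assert (acos (x / r) <> 0); [|lra].
  intros H. rewrite H, sin_0, Rabs_left in Hsin by assumption.
  assert (0 < - y / r) by (apply Rdiv_lt_0_compat; lra). lra.
Qed.

(** Cauchy-Schwarz against the constant 1, obtained by integrating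
    [0 <= (e - (b - a) * I y)^2 / (b - a)], where [e] is the integral of [I]. *)
Lemma RInt_sqr_le (I F : R -> R) (a b C : R) :
  a < b ->
  (forall y, continuous I y) -> (forall y, continuous F y) ->
  (forall y, I y ^ 2 <= C * F y) ->
  RInt I a b ^ 2 <= (b - a) * C * RInt F a b.
Proof.
intros Hab cI cF HI.
assert (eI : is_RInt I a b (RInt I a b)).
{ apply (RInt_correct (V := R_CompleteNormedModule)).
  apply (ex_RInt_continuous (V := R_CompleteNormedModule)); auto. }
assert (eF : is_RInt F a b (RInt F a b)).
{ apply (RInt_correct (V := R_CompleteNormedModule)).
  apply (ex_RInt_continuous (V := R_CompleteNormedModule)); auto. }
set (e := RInt I a b) in *.
assert (K : scal (2 * e) e
  <= plus (scal (b - a) (e ^ 2 / (b - a))) (scal ((b - a) * C) (RInt F a b))).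
{ apply (is_RInt_le (fun y => scal (2 * e) (I y))
    (fun y => plus (e ^ 2 / (b - a)) (scal ((b - a) * C) (F y))) a b); [lra| | |].
  - now apply (is_RInt_scal (V := R_NormedModule)).
  - apply (is_RInt_plus (V := R_NormedModule)).
    + apply (is_RInt_const (V := R_NormedModule)).
    + now apply (is_RInt_scal (V := R_NormedModule)).
  - intros y _. unfold plus, scal; simpl; unfold mult; simpl.
    assert (K1 : (b - a) * I y ^ 2 <= (b - a) * (C * F y))
      by (apply Rmult_le_compat_l; [lra|apply HI]).
    assert (K2 : 0 <= (e - (b - a) * I y) ^ 2 / (b - a))
      by (apply Rdiv_le_0_compat; [apply pow2_ge_0|lra]).
    replace ((e - (b - a) * I y) ^ 2 / (b - a))
      with (e ^ 2 / (b - a) - 2 * e * I y + (b - a) * I y ^ 2) in K2 by (field; lra).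
    lra. }
unfold plus, scal in K; simpl in K; unfold mult in K; simpl in K.
replace ((b - a) * (e * (e * 1) / (b - a))) with (e ^ 2) in K by (field; lra).
lra.
Qed.

Ltac cont :=
  lazymatch goal with
  | |- continuous (fun _ => _ * _) _ => apply (continuous_mult (K := R_AbsRing)); cont
  | |- continuous (fun _ => _ - _) _ => apply (continuous_minus (V := R_NormedModule)); cont
  | |- continuous (fun _ => _ + _) _ => apply (continuous_plus (V := R_NormedModule)); cont
  | |- continuous (fun _ => - _) _ => apply (continuous_opp (V := R_NormedModule)); cont
  | |- continuous (fun _ => ?k) _ => apply continuous_const
  | |- continuous cos _ => apply continuous_cos
  | |- continuous sin _ => apply continuous_sin
  | |- continuous (fun _ => cos _) _ => apply continuous_cos
  | |- continuous (fun _ => sin _) _ => apply continuous_sin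
  | H : forall r p, continuous (?W r) p |- continuous (fun _ => ?W _ _) _ => apply H
  | H : forall r p, continuous (?W r) p |- continuous (?W _) _ => apply H
  | H : forall f : R -> R -> R, _ -> forall r p, continuous _ p |- _ => apply H; assumption
  end.

(* The derivative in [r] of the circulation of [q (v2 dv1 - v1 dv2)] along the
   circle of radius [r] is the integral of [density] over that circle. *)
Lemma circulation_vanish (v1 v2 a b c q sigma : R -> R -> R) (C : R) :
  let density x y := (2 * q x y + sigma x y * (v1 x y ^ 2 + v2 x y ^ 2))
    * (b x y ^ 2 - a x y * c x y) in
  C1_plane v1 a b -> C1_plane v2 b c ->
  C1_plane q (fun x y => sigma x y * (v1 x y * a x y + v2 x y * b x y))
             (fun x y => sigma x y * (v1 x y * b x y + v2 x y * c x y)) ->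
  (forall x y, continuity_2d_pt sigma x y) ->
  0 < C ->
  (forall x y, 0 <= density x y) ->
  (forall r p, 0 < r ->
     let x := r * cos p in let y := r * sin p in
     (q x y * (v1 x y * (b x y * - sin p + c x y * cos p)
               - v2 x y * (a x y * - sin p + b x y * cos p))) ^ 2
     <= C * density x y) ->
  forall x y, (x, y) <> (0, 0) -> density x y = 0.
Proof.
intros density Hv1 Hv2 Hq Csig HC Hpos Hbound.
assert (Pv1 := C1_plane_polar _ _ _ Hv1).
assert (Pv2 := C1_plane_polar _ _ _ Hv2).
assert (Pq := C1_plane_polar _ _ _ Hq).
assert (HPI := PI_RGT_0).
assert (per : forall (f : R -> R -> R) s,
  f (s * cos (2 * PI)) (s * sin (2 * PI)) = f (s * cos 0) (s * sin 0)).
{ intros. now rewrite cos_2PI, sin_2PI, cos_0, sin_0. }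
(* The circulations of [q v2 dv1] and [q v1 dv2] are differentiated separately. [E] below is their
   difference, and [r * W] is the integrand of [q (v1 dv2 - v2 dv1)]. *)
assert (D12 := fun r => is_derive_circulation _ _ _ _ _ _ (2 * PI) r ltac:(lra)
  (C1_plane_mult _ _ _ _ _ _ Pq Pv2) Pv1
  (fun s => per (fun x y => q x y * v2 x y) s) (per v1)).
assert (D21 := fun r => is_derive_circulation _ _ _ _ _ _ (2 * PI) r ltac:(lra)
  (C1_plane_mult _ _ _ _ _ _ Pq Pv1) Pv2
  (fun s => per (fun x y => q x y * v1 x y) s) (per v2)).
cbv beta in D12, D21.
assert (Cv1 := fun x y => C1_plane_continuity _ _ _ x y Hv1).
assert (Cv2 := fun x y => C1_plane_continuity _ _ _ x y Hv2).
assert (Cq := fun x y => C1_plane_continuity _ _ _ x y Hq).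
destruct Hv1 as (_ & _ & Ca & Cb), Hv2 as (_ & _ & _ & Cc).
assert (Csqr : forall f : R -> R -> R, (forall x y, continuity_2d_pt f x y) ->
  forall x y, continuity_2d_pt (fun x y => f x y ^ 2) x y).
{ intros f Hf x y. apply (continuity_2d_pt_ext (fun x y => f x y * f x y)); [intros; ring|].
  apply continuity_2d_pt_mult; auto. }
assert (Cdens : forall x y, continuity_2d_pt density x y).
{ intros x y. apply continuity_2d_pt_mult.
  - apply continuity_2d_pt_plus; apply continuity_2d_pt_mult; auto.
    + apply continuity_2d_pt_const.
    + apply continuity_2d_pt_plus; auto.
  - apply continuity_2d_pt_minus; auto. apply continuity_2d_pt_mult; auto. }
assert (Cpolar : forall f : R -> R -> R, (forall x y, continuity_2d_pt f x y) ->
  forall r p, continuous (fun p => f (r * cos p) (r * sin p)) p).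
{ intros f Hf r p.
  apply (continuity_2d_pt_section (fun r p => f (r * cos p) (r * sin p))).
  now apply polar_continuity. }
set (W := fun r p => let x := r * cos p in let y := r * sin p in
  q x y * (v1 x y * (b x y * - sin p + c x y * cos p)
               - v2 x y * (a x y * - sin p + b x y * cos p))) in *.
assert (CW : forall r p, continuous (W r) p) by (intros; unfold W; cbv beta zeta; cont).
assert (ex : forall f : R -> R, (forall p, continuous f p) -> ex_RInt f 0 (2 * PI)).
{ intros f Hf. apply (ex_RInt_continuous (V := R_CompleteNormedModule)); auto. }
set (E := fun r => - RInt (fun p => r * W r p) 0 (2 * PI)).
set (E' := fun r => RInt (fun p => r * density (r * cos p) (r * sin p)) 0 (2 * PI)).
assert (HE : forall r, is_derive E r (E' r)).
{ intros r.
  generalize (is_derive_minus (V := R_NormedModule) _ _ _ _ _ (D12 r) (D21 r)). clear D12 D21.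
  intros D. evar_last.
  - refine (is_derive_ext _ _ _ _ _ D). intros s. unfold E.
    rewrite <- (RInt_minus (V := R_CompleteNormedModule)) by (apply ex; intros; cont).
    rewrite <- (RInt_opp (V := R_CompleteNormedModule)) by (apply ex; intros; cont).
    apply RInt_ext. unfold W; ring_R.
  - unfold E'.
    rewrite <- (RInt_minus (V := R_CompleteNormedModule)) by (apply ex; intros; cont).
    apply RInt_ext. intros p _.
    (* The Jacobian of polar coordinates appears as [r * (sin^2 + cos^2)]. *)
    transitivity (r * density (r * cos p) (r * sin p) * ((sin p)² + (cos p)²)).
    + unfold density, Rsqr; ring_R.
    + rewrite sin2_cos2. apply Rmult_1_r. }
assert (HE'pos : forall r, 0 < r -> 0 <= E' r).
{ intros r Hr. apply RInt_ge_0; [lra|apply ex; intros; cont|].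
  intros p _. apply Rmult_le_pos; [lra|apply Hpos]. }
assert (Hvan : forall r, 0 <= r -> E r = 0).
{ apply (sqr_le_derive_vanish E E' (2 * PI * C)); trivial.
  - apply Rmult_lt_0_compat; lra.
  - unfold E. rewrite (RInt_ext _ (fun _ => 0)) by ring_R.
    rewrite RInt_const. ring_R.
  - intros r Hr. unfold E, E'.
    replace ((- RInt (fun p => r * W r p) 0 (2 * PI)) ^ 2)
      with (RInt (fun p => r * W r p) 0 (2 * PI) ^ 2) by ring.
    replace (2 * PI * C * r) with ((2 * PI - 0) * (C * r)) by ring.
    apply RInt_sqr_le; [lra|intros; cont|intros; cont|].
    intros p. rewrite Rpow_mult_distr.
    replace (C * r * (r * density (r * cos p) (r * sin p)))
      with (r ^ 2 * (C * density (r * cos p) (r * sin p))) by ring.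
    apply Rmult_le_compat_l; [apply pow2_ge_0|now apply Hbound]. }
intros x y Hxy.
destruct (polar_coordinates x y Hxy) as [r [p [Hr [Hp [-> ->]]]]].
(* [E] vanishes on the half-line, hence near the interior point [r], so its derivative there is
   zero; the nonnegative integrand must then vanish on the whole circle. *)
assert (HE'0 : E' r = 0).
{ rewrite <- (is_derive_unique _ _ _ (HE r)).
  rewrite (Derive_ext_loc E (fun _ => 0)); [apply Derive_const|].
  exists (mkposreal r Hr). intros z Hz. apply Hvan.
  apply Rabs_def2 in Hz. simpl in Hz. unfold minus, plus, opp in Hz; simpl in Hz. lra. }
assert (K := RInt_eq_0_nonneg (fun p => r * density (r * cos p) (r * sin p)) 0 (2 * PI) p
  ltac:(intros; cont)
  ltac:(intros; apply Rmult_le_pos; [lra|apply Hpos]) HE'0 Hp).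
simpl in K. apply Rmult_integral in K. destruct K as [K|K]; [lra|exact K].
Qed.

(** * Regularity of the weighted slope *)

Lemma D_in_continuous_on (f f' : R -> R) (D : R -> Prop) :
  (forall t, D t -> D_in f f' D t) -> continuous_on D f.
Proof.
intros H t Ht. apply filterlim_locally. intros eps.
destruct (cont_deriv f f' D t (H t Ht) eps (cond_pos eps)) as [d [Hd K]].
exists (mkposreal d Hd). intros z Hz Dz.
destruct (Req_dec z t) as [->|Hne].
- apply ball_center.
- apply K. split; [|exact Hz]. split; auto.
Qed.

Lemma D_in_halfline_is_derive (f f' : R -> R) (t : R) :
  0 < t -> D_in f f' Defs.nonneg t -> is_derive f t (f' t).
Proof.
intros Ht H. apply is_derive_Reals, derivable_pt_lim_D_in.
intros eps Heps. destruct (H eps Heps) as [d [Hd K]].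
(* A radius at most [t] keeps [z] inside the half-line. *)
exists (Rmin d t). split; [now apply Rmin_pos|].
intros z [[_ Hz] Hdist].
assert (Hd1 := Rlt_le_trans _ _ _ Hdist (Rmin_l _ _)).
assert (Hd2 := Rlt_le_trans _ _ _ Hdist (Rmin_r _ _)).
apply K. split; [|exact Hd1]. split; [|exact Hz].
simpl in Hd2. unfold Rdist in Hd2. apply Rabs_def2 in Hd2. unfold Defs.nonneg. lra.
Qed.

Lemma continuous_on_nonneg_comp (f p : R -> R) (x : R) :
  continuous_on Defs.nonneg f -> (forall z, 0 <= p z) -> continuous p x ->
  continuous (fun z => f (p z)) x.
Proof.
intros Hf Hp Hc. apply filterlim_comp with (2 := Hf (p x) (Hp x)).
intros P HP. generalize (Hc _ HP). unfold filtermap.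
apply filter_imp. intros z Hz. apply Hz, Hp.
Qed.

(** Two applications of the mean value theorem: on [[0, t / 2]] the intermediate point may be 0,
    which gives only [g' (t / 2) >= 0]; on [[t / 2, t]] the increase is strict. *)
Lemma convex_derivative_pos (g' g'' : R -> R) :
  (forall t, Defs.nonneg t -> D_in g' g'' Defs.nonneg t) ->
  g' 0 = 0 -> (forall t, 0 < t -> 0 < g'' t) -> 0 <= g'' 0 ->
  forall t, 0 < t -> 0 < g' t.
Proof.
intros H H0 Hpos Hpos0 t Ht.
assert (Hd := fun z Hz => D_in_halfline_is_derive g' g'' z Hz (H z (Rlt_le _ _ Hz))).
assert (K : 0 <= g' (t / 2)).
{ destruct (MVT_gen (fun z => g' (Rabs z)) 0 (t / 2) g'') as [c [Hc E]];
    try rewrite Rmin_left, Rmax_right in * by lra.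
  - intros z Hz. apply (is_derive_ext_loc g'); [|apply Hd; lra].
    exists (mkposreal z (proj1 Hz)). intros y Hy.
    apply Rabs_def2 in Hy. unfold minus, plus, opp in Hy; simpl in Hy.
    rewrite Rabs_pos_eq by lra. reflexivity.
  - intros z _. apply continuity_pt_filterlim.
    apply (continuous_on_nonneg_comp g' Rabs);
      [now apply D_in_continuous_on with g''|apply Rabs_pos|apply continuous_Rabs].
  - rewrite !Rabs_pos_eq, H0 in E by lra.
    assert (0 <= g'' c).
    { destruct (proj1 Hc) as [Hlt|<-]; [left; now apply Hpos|assumption]. }
    nra. }
destruct (MVT_cor2 g' g'' (t / 2) t) as [c [E Hc]]; [lra| |].
- intros z Hz. apply is_derive_Reals, Hd. lra.
- assert (0 < g'' c) by (apply Hpos; lra). nra.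
Qed.

Lemma linear_growth_derivative_le (g g' g'' : R -> R) (m M : R) :
  (forall t, 0 < t -> is_derive g t (g' t)) ->
  (forall t, 0 < t -> is_derive g' t (g'' t)) ->
  (forall t, 0 < t -> 0 < g'' t) ->
  0 < m -> 0 < M ->
  (forall t, 0 <= t -> m * (t - 1) <= g t /\ g t <= M * (t + 1)) ->
  forall t, 0 < t -> g' t <= M.
Proof.
intros Hg Hg' Hpos Hm HM Hgrow t Ht.
destruct (Rle_lt_dec (g' t) M) as [|Hlt]; [assumption|exfalso].
(* By convexity [g (t + h) >= g t + h * g' t]. With this [h] and [g t >= m * (t - 1)], the
   right-hand side exceeds [M * (t + h + 1)]. *)
set (h := (M * (t + 1) + m + 1) / (g' t - M)).
assert (Hnum : 0 < M * (t + 1)) by (apply Rmult_lt_0_compat; lra).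
assert (Hh : 0 < h) by (apply Rdiv_lt_0_compat; lra).
assert (Hh' : h * (g' t - M) = M * (t + 1) + m + 1) by (unfold h; field; lra).
destruct (MVT_cor2 g g' t (t + h)) as [c [E Hc]]; [lra| |].
{ intros z Hz. apply is_derive_Reals, Hg. lra. }
destruct (MVT_cor2 g' g'' t c) as [d [E' Hd]]; [lra| |].
{ intros z Hz. apply is_derive_Reals, Hg'. lra. }
assert (0 < g'' d) by (apply Hpos; lra).
assert (g' t * h <= g' c * h) by (apply Rmult_le_compat_r; nra).
assert (U := proj2 (Hgrow (t + h) ltac:(lra))).
assert (L := proj1 (Hgrow t ltac:(lra))).
assert (0 < m * t) by now apply Rmult_lt_0_compat.
replace (t + h - t) with h in E by ring. lra.
Qed.

Lemma weight'_continuous (s : R) : 0 <= s -> continuous weight' s.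
Proof.
intros Hs. apply (continuous_plus (V := R_NormedModule)).
- apply (ex_derive_continuous damp). eexists; now apply damp_derive.
- apply (continuous_mult (K := R_AbsRing)); [apply continuous_id|now apply damp'_continuous].
Qed.

Definition weighted_slope (g' : R -> R) (s : R) : R := weight s * g' (sqrt s).

(** Twice the derivative in [s], the 2 coming from the differential of [p1^2 + p2^2]. The [/ sqrt s]
    from differentiating [sqrt] is cancelled against [weight s = s * damp s], so that the formula is
    continuous up to [s = 0]. *)
Definition weighted_slope' (g' g'' : R -> R) (s : R) : R :=
  2 * weight' s * g' (sqrt s) + damp s * sqrt s * g'' (sqrt s).

Lemma weighted_slope'_continuous (g' g'' : R -> R) (s : R) :
  continuous_on Defs.nonneg g' -> continuous_on Defs.nonneg g'' -> 0 <= s ->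
  continuous (weighted_slope' g' g'') s.
Proof.
intros H' H'' Hs. unfold weighted_slope'.
apply (continuous_plus (V := R_NormedModule));
  apply (continuous_mult (K := R_AbsRing)).
- apply (continuous_mult (K := R_AbsRing)); [apply continuous_const|now apply weight'_continuous].
- apply continuous_on_nonneg_comp; [assumption|apply sqrt_pos|apply continuous_sqrt].
- apply (continuous_mult (K := R_AbsRing)); [|apply continuous_sqrt].
  apply (ex_derive_continuous damp). eexists; now apply damp_derive.
- apply continuous_on_nonneg_comp; [assumption|apply sqrt_pos|apply continuous_sqrt].
Qed.

(** As [f x = 0], the difference quotient of the product is that of [f] times [h z], so continuity
    of [h] suffices. *)
Lemma is_derive_mult_vanish (f h : R -> R) (x l : R) :
  is_derive f x l -> f x = 0 -> continuous h x ->
  is_derive (fun z => f z * h z) x (l * h x).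
Proof.
intros Hf H0 Hh. apply is_derive_Reals in Hf. apply is_derive_Reals.
apply derivable_pt_lim_D_in with (df := fun _ => l) in Hf.
apply (derivable_pt_lim_D_in _ (fun _ => l * h x)).
apply continuity_pt_filterlim in Hh.
assert (K := limit_mul _ _ _ _ _ _ Hf Hh).
intros eps Heps. destruct (K eps Heps) as [d [Hd D]]. exists d. split; [exact Hd|].
intros z Hz. generalize (D z Hz).
replace ((f z * h z - f x * h x) / (z - x)) with ((f z - f x) / (z - x) * h z); [trivial|].
rewrite H0. field. destruct Hz as [[_ Hz] _]. lra.
Qed.

(* Where the curve meets the origin [sqrt] is not differentiable, but
   [weight s = s * damp s] vanishes there to second order. *)
Lemma weighted_slope_derive (g' g'' : R -> R) (p1 p2 : R -> R) (x d1 d2 : R) :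
  (forall t, 0 < t -> is_derive g' t (g'' t)) -> continuous_on Defs.nonneg g' ->
  is_derive p1 x d1 -> is_derive p2 x d2 ->
  is_derive (fun z => weighted_slope g' (p1 z ^ 2 + p2 z ^ 2)) x
    (weighted_slope' g' g'' (p1 x ^ 2 + p2 x ^ 2) * (p1 x * d1 + p2 x * d2)).
Proof.
intros Hd Hc H1 H2.
set (s := fun z => p1 z ^ 2 + p2 z ^ 2).
assert (Hs : forall z, 0 <= s z).
{ intros z. unfold s. generalize (pow2_ge_0 (p1 z)) (pow2_ge_0 (p2 z)). lra. }
assert (Ds : is_derive s x (2 * (p1 x * d1 + p2 x * d2))).
{ unfold s. auto_derive.
  - repeat split; eexists; eassumption.
  - replace (Derive (fun x => p1 x) x) with d1 by (symmetry; now apply is_derive_unique).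
    replace (Derive (fun x => p2 x) x) with d2 by (symmetry; now apply is_derive_unique).
    ring. }
assert (Cs : continuous s x) by (apply (ex_derive_continuous s); eexists; exact Ds).
change (p1 x ^ 2 + p2 x ^ 2) with (s x).
destruct (Hs x) as [Hpos|Hz].
- assert (Ht : 0 < sqrt (s x)) by now apply sqrt_lt_R0.
  apply (is_derive_ext (fun z => weight (s z) * g' (sqrt (s z)))); [reflexivity|].
  assert (D1 := is_derive_comp weight s x _ _ (weight_derive (s x) (Hs x)) Ds).
  assert (D2 := is_derive_comp g' (fun z => sqrt (s z)) x _ _ (Hd _ Ht)
                  (is_derive_sqrt s x _ Ds Hpos)).
  assert (D := is_derive_mult (K := R_AbsRing) _ _ _ _ _ D1 D2 Rmult_comm).
  evar_last; [exact D|].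
  unfold weighted_slope', weight, plus, scal, mult; simpl; unfold mult; simpl.
  assert (Hsq : s x = sqrt (s x) * sqrt (s x)) by (symmetry; apply sqrt_sqrt, Hs).
  set (t := sqrt (s x)) in *. clearbody t.
  generalize (weight' (s x)) (damp (s x)). intros w d. rewrite Hsq. field. lra.
- assert (Z1 : p1 x = 0).
  { generalize (pow2_ge_0 (p1 x)) (pow2_ge_0 (p2 x)). unfold s in Hz. nra. }
  assert (Z2 : p2 x = 0).
  { generalize (pow2_ge_0 (p1 x)) (pow2_ge_0 (p2 x)). unfold s in Hz. nra. }
  (* Here the slope is [p1 * (p1 * k) + p2 * (p2 * k)] with [p1], [p2] zero at [x] and [k] only
     continuous; the derivative is zero. *)
  set (k := fun z => damp (s z) * g' (sqrt (s z))).
  assert (Ck : continuous k x).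
  { apply (continuous_mult (K := R_AbsRing)).
    - apply (continuous_comp s damp); [assumption|].
      apply (ex_derive_continuous damp). eexists; now apply damp_derive.
    - apply continuous_on_nonneg_comp; [assumption|intros; apply sqrt_pos|].
      now apply continuous_sqrt_comp. }
  apply (is_derive_ext (fun z => p1 z * (p1 z * k z) + p2 z * (p2 z * k z))).
  { intros z. unfold k, weighted_slope, weight, s. simpl. ring. }
  evar_last.
  + apply (is_derive_plus (V := R_NormedModule)).
    * apply (is_derive_mult_vanish p1 (fun z => p1 z * k z)); [eassumption|exact Z1|].
      apply (continuous_mult (K := R_AbsRing)); [|exact Ck].
      apply (ex_derive_continuous p1). eexists; eassumption.
    * apply (is_derive_mult_vanish p2 (fun z => p2 z * k z)); [eassumption|exact Z2|].
      apply (continuous_mult (K := R_AbsRing)); [|exact Ck].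
      apply (ex_derive_continuous p2). eexists; eassumption.
  + rewrite Z1, Z2. unfold plus; simpl. ring.
Qed.

(** * Liouville property *)

(** The mean value theorem on the segment from the origin uses an interior point, which is never the
    origin, so the exceptional point is harmless. *)
Lemma C1_plane_constant (f fx fy : R -> R -> R) :
  C1_plane f fx fy ->
  (forall x y, (x, y) <> (0, 0) -> fx x y = 0 /\ fy x y = 0) ->
  forall x y, f x y = f 0 0.
Proof.
intros Hf Hz x y.
assert (Hxy : (x, y) = (0, 0) \/ (x, y) <> (0, 0)).
{ destruct (Req_dec x 0) as [->|Hx]; [destruct (Req_dec y 0) as [->|Hy]|];
    [now left| |]; right; congruence. }
destruct Hxy as [Hxy|Hxy]; [now injection Hxy as -> ->|].
destruct (MVT_cor2 (fun t => f (t * x) (t * y))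
  (fun t => fx (t * x) (t * y) * x + fy (t * x) (t * y) * y) 0 1) as [t [E Ht]].
- lra.
- intros t _. apply is_derive_Reals.
  apply (C1_plane_curve f fx fy (fun t => t * x) (fun t => t * y)); trivial;
    auto_derive; trivial; ring.
- rewrite !Rmult_0_l, !Rmult_1_l in E.
  destruct (Hz (t * x) (t * y)) as [Ex Ey].
  + intros H. apply Hxy. injection H as H1 H2. f_equal; nra.
  + rewrite Ex, Ey in E. lra.
Qed.

(** Away from the origin the gradient or the Hessian vanishes, so [|grad u|^2] has zero derivative
    and is constant. If the constant is 0, the gradient vanishes everywhere; otherwise it vanishes
    nowhere and the Hessian is zero off the origin. *)
Lemma affine_of_hessian (u v1 v2 a b c : R -> R -> R) :
  C1_plane u v1 v2 -> C1_plane v1 a b -> C1_plane v2 b c ->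
  (forall x y, (x, y) <> (0, 0) -> 0 < v1 x y ^ 2 + v2 x y ^ 2 ->
     a x y = 0 /\ b x y = 0 /\ c x y = 0) ->
  affine u.
Proof.
intros Hu H1 H2 Hz.
assert (Hn : forall x y, (x, y) <> (0, 0) ->
  (v1 x y = 0 /\ v2 x y = 0) \/ (a x y = 0 /\ b x y = 0 /\ c x y = 0)).
{ intros x y Hxy. destruct (Rlt_le_dec 0 (v1 x y ^ 2 + v2 x y ^ 2)) as [Hp|Hp].
  - right. now apply Hz.
  - left. generalize (pow2_ge_0 (v1 x y)) (pow2_ge_0 (v2 x y)). intros. split; nra. }
assert (Hnorm := C1_plane_constant _ _ _
  (C1_plane_plus _ _ _ _ _ _ (C1_plane_mult _ _ _ _ _ _ H1 H1)
     (C1_plane_mult _ _ _ _ _ _ H2 H2))).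
cbv beta in Hnorm.
assert (Hconst : forall x y, v1 x y * v1 x y + v2 x y * v2 x y
  = v1 0 0 * v1 0 0 + v2 0 0 * v2 0 0).
{ apply Hnorm. intros x y Hxy.
  destruct (Hn x y Hxy) as [[-> ->]|[-> [-> ->]]]; split; ring. }
assert (Hv : forall x y, v1 x y = v1 0 0 /\ v2 x y = v2 0 0).
{ destruct (Req_dec (v1 0 0 * v1 0 0 + v2 0 0 * v2 0 0) 0) as [H0|H0].
  - assert (Hv0 : forall x y, v1 x y = 0 /\ v2 x y = 0).
    { intros x y. specialize (Hconst x y). rewrite H0 in Hconst. split; nra. }
    intros x y. now rewrite (proj1 (Hv0 x y)), (proj2 (Hv0 x y)),
      (proj1 (Hv0 0 0)), (proj2 (Hv0 0 0)).
  - assert (HH : forall x y, (x, y) <> (0, 0) -> a x y = 0 /\ b x y = 0 /\ c x y = 0).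
    { intros x y Hxy. destruct (Hn x y Hxy) as [[E1 E2]|]; [|assumption].
      elim H0. rewrite <- (Hconst x y), E1, E2. ring. }
    intros x y. split.
    + apply (C1_plane_constant v1 a b); trivial.
      intros p q Hpq. destruct (HH p q Hpq) as [? [? ?]]. auto.
    + apply (C1_plane_constant v2 b c); trivial.
      intros p q Hpq. destruct (HH p q Hpq) as [? [? ?]]. auto. }
exists (v1 0 0), (v2 0 0), (u 0 0). intros x y.
assert (Hl : C1_plane (fun x y => - v1 0 0 * x - v2 0 0 * y)
               (fun _ _ => - v1 0 0) (fun _ _ => - v2 0 0)).
{ split; [|split; [|split]]; intros p q.
  - auto_derive; trivial; ring.
  - auto_derive; trivial; ring.
  - apply continuity_2d_pt_const.
  - apply continuity_2d_pt_const. }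
assert (E := C1_plane_constant _ _ _ (C1_plane_plus _ _ _ _ _ _ Hu Hl)).
cbv beta in E. specialize (E ltac:(intros p q _; destruct (Hv p q) as [-> ->]; split; ring) x y).
lra.
Qed.

(** Schwarz's theorem makes the mixed derivative one function [b]. *)
Lemma C2_plane_C1 (u : R -> R -> R) : C2_plane u ->
  let v1 x y := Derive (fun z => u z y) x in
  let v2 x y := Derive (fun z => u x z) y in
  exists a b c, C1_plane u v1 v2 /\ C1_plane v1 a b /\ C1_plane v2 b c.
Proof.
intros Hu v1 v2.
exists (fun x y => Derive (fun z => v1 z y) x), (fun x y => Derive (fun z => v1 x z) y),
  (fun x y => Derive (fun z => v2 x z) y).
assert (H1 : C1_plane v1 (fun x y => Derive (fun z => v1 z y) x)
               (fun x y => Derive (fun z => v1 x z) y)).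
{ split; [|split; [|split]]; intros x y;
    destruct (Hu x y) as (_ & _ & _ & (_ & E1 & E2 & [C1 _] & [C2 _]) & _).
  - apply Derive_correct, E1.
  - apply (Derive_correct (fun z => v1 x z)), E2.
  - exact C1.
  - exact C2. }
assert (H2 : C1_plane v2 (fun x y => Derive (fun z => v2 z y) x)
               (fun x y => Derive (fun z => v2 x z) y)).
{ split; [|split; [|split]]; intros x y;
    destruct (Hu x y) as (_ & _ & _ & _ & (_ & E1 & E2 & [C1 _] & [C2 _])).
  - apply Derive_correct, E1.
  - apply (Derive_correct (fun z => v2 x z)), E2.
  - exact C1.
  - exact C2. }
split; [|split; [exact H1|]].
- split; [|split; [|split]]; intros x y.
  + destruct (Hu x y) as (_ & E1 & _). apply Derive_correct, E1.
  + destruct (Hu x y) as (_ & _ & E2 & _). apply (Derive_correct (fun z => u x z)), E2.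
  + eapply C1_plane_continuity, H1.
  + eapply C1_plane_continuity, H2.
- assert (S : forall x y, Derive (fun z => v1 x z) y = Derive (fun z => v2 z y) x).
  { intros x y. symmetry. apply (Schwarz u x y).
    - apply locally_2d_forall. intros p q.
      destruct (Hu p q) as (_ & E1 & E2 & (_ & _ & E12 & _) & (_ & E21 & _)).
      repeat split; assumption.
    - apply H2.
    - apply H1. }
  destruct H2 as (Dx & Dy & Cx & Cy).
  split; [|split; [|split]]; intros x y.
  + rewrite S. apply Dx.
  + apply Dy.
  + apply H1.
  + apply Cy.
Qed.

(** [p] is kept apart from [p1] and [p2] so that both terms of the divergence are covered: [p] is
    the first component along the first variable and the second component along the second. *)
Lemma flux_component_derive (g' g'' : R -> R) (p p1 p2 : R -> R) (x d d1 d2 : R) :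
  (forall t, 0 < t -> is_derive g' t (g'' t)) ->
  is_derive p x d -> is_derive p1 x d1 -> is_derive p2 x d2 ->
  let t := euclid (p1 x, p2 x) in
  0 < t ->
  is_derive (fun z => g' (euclid (p1 z, p2 z)) / euclid (p1 z, p2 z) * p z) x
    (g' t / t * d + (g'' t - g' t / t) / t ^ 2 * (p1 x * d1 + p2 x * d2) * p x).
Proof.
intros Hg Hp H1 H2 t Ht.
set (e := fun z => euclid (p1 z, p2 z)).
assert (De : is_derive e x ((p1 x * d1 + p2 x * d2) / t)).
{ assert (D : is_derive (fun z => p1 z * p1 z + p2 z * p2 z) x (2 * (p1 x * d1 + p2 x * d2))).
  { evar_last.
    - apply (is_derive_plus (V := R_NormedModule));
        apply (is_derive_mult (K := R_AbsRing)); eauto using Rmult_comm.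
    - ring_R. }
  unfold e, euclid, dot; simpl.
  evar_last.
  - apply is_derive_sqrt; [exact D|].
    apply sqrt_lt_0_alt. rewrite sqrt_0. exact Ht.
  - transitivity (2 * (p1 x * d1 + p2 x * d2) / (2 * t)); [reflexivity|].
    match goal with |- ?l = ?r => change (l = r :> R) end. field. lra. }
assert (Dg := is_derive_comp g' e x _ _ (Hg _ Ht) De).
change (is_derive (fun z => g' (e z) / e z * p z) x
  (g' t / t * d + (g'' t - g' t / t) / t ^ 2 * (p1 x * d1 + p2 x * d2) * p x)).
evar_last.
- apply (is_derive_mult (K := R_AbsRing) (fun z => g' (e z) / e z) p);
    [|exact Hp|apply Rmult_comm].
  apply (is_derive_div (fun z => g' (e z)) e); [exact Dg|exact De|]. apply Rgt_not_eq, Ht.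
- change (e x) with t. unfold plus, scal, mult; simpl; unfold mult; simpl. field. lra.
Qed.

Lemma equation_nondivergence (g' g'' : R -> R) (v1 v2 a b c : R -> R -> R) (x y : R) :
  (forall t, 0 < t -> is_derive g' t (g'' t)) ->
  C1_plane v1 a b -> C1_plane v2 b c ->
  divergence (fun y1 y2 => flux g' (v1 y1 y2, v2 y1 y2)) x y = 0 ->
  let t := euclid (v1 x y, v2 x y) in
  0 < t ->
  t * g'' t * (a x y * v1 x y ^ 2 + 2 * b x y * v1 x y * v2 x y + c x y * v2 x y ^ 2)
  + g' t * (a x y * v2 x y ^ 2 - 2 * b x y * v1 x y * v2 x y + c x y * v1 x y ^ 2) = 0.
Proof.
intros Hg H1 H2 Hdiv t Ht.
assert (Ht2 : t ^ 2 = v1 x y ^ 2 + v2 x y ^ 2).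
{ unfold t, euclid, dot. simpl fst; simpl snd.
  rewrite pow2_sqrt; [ring|]. generalize (Rle_0_sqr (v1 x y)) (Rle_0_sqr (v2 x y)).
  unfold Rsqr. lra. }
destruct H1 as (D1x & D1y & _ & _), H2 as (D2x & D2y & _ & _).
assert (Ex := flux_component_derive g' g'' (fun z => v1 z y) (fun z => v1 z y)
  (fun z => v2 z y) x _ _ _ Hg (D1x x y) (D1x x y) (D2x x y) Ht).
assert (Ey := flux_component_derive g' g'' (v2 x) (v1 x) (v2 x) y _ _ _
  Hg (D2y x y) (D1y x y) (D2y x y) Ht).
apply is_derive_unique in Ex. apply is_derive_unique in Ey.
assert (E := eq_trans (eq_sym (f_equal2 Rplus Ex Ey)) Hdiv).
cbv beta in E. fold t in E.
set (rho := g' t / t) in *. set (k := (g'' t - rho) / t ^ 2) in *.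
replace (g' t) with (rho * t) by (unfold rho; field; lra).
replace (g'' t) with (rho + k * t ^ 2) by (unfold k; field; lra).
rewrite Ht2.
(* The expanded divergence times [t * |grad u|^2] is the required form. *)
match type of E with ?l = 0 => transitivity (t * (v1 x y ^ 2 + v2 x y ^ 2) * l) end.
- ring.
- rewrite E. ring.
Qed.

Theorem theorem1p4
  (g g' g'' : R -> R)
  (Hg : C2_halfline g g' g'')
  (Hg'0 : g' 0 = 0)
  (Hg''pos : forall t : R, 0 < t -> 0 < g'' t)
  (Hg''0 : 0 <= g'' 0)
  (Hgrowth : exists m M : R, 0 < m /\ 0 < M /\
     forall t : R, 0 <= t -> m * (t - 1) <= g t /\ g t <= M * (t + 1))
  (Hlimsup : Rbar_lt (LimSup_p_infty (fun t => g'' t * t * (ln t) ^ 2)) p_infty)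
  (u : R -> R -> R)
  (Hu : C2_plane u)
  (Hsol : entire_solution g' u)
  (Htan : exists K : R, forall x1 x2 : R, (x1, x2) <> (0, 0) ->
     ln (1 + euclid (gradient u x1 x2)) * Rabs (tangential_derivative u x1 x2)
       <= K * (1 + euclid (gradient u x1 x2))) :
  affine u.
Proof.
destruct Hg as (Dg & Dg' & Cg'').
assert (dg : forall t, 0 < t -> is_derive g t (g' t)).
{ intros t Ht. apply D_in_halfline_is_derive; [assumption|]. apply Dg. unfold Defs.nonneg; lra. }
assert (dg' : forall t, 0 < t -> is_derive g' t (g'' t)).
{ intros t Ht. apply D_in_halfline_is_derive; [assumption|]. apply Dg'. unfold Defs.nonneg; lra. }
assert (Cg' := D_in_continuous_on g' g'' Defs.nonneg Dg').
assert (g'pos := convex_derivative_pos g' g'' Dg' Hg'0 Hg''pos Hg''0).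
destruct Hgrowth as (m & M & Hm & HM & Hgrow).
assert (g'le := linear_growth_derivative_le g g' g'' m M dg dg' Hg''pos Hm HM Hgrow).
destruct Htan as [K0 Htan].
destruct (C2_plane_C1 u Hu) as (a & b & c & HuC & H1 & H2).
set (v1 := fun x y => Derive (fun z => u z y) x) in *.
set (v2 := fun x y => Derive (fun z => u x z) y) in *.
(* The given constant has no sign, whereas [tangential_logw] asks for a nonnegative one; [C0] is the
   constant produced there. *)
set (K := Rabs K0). assert (HK : 0 <= K) by apply Rabs_pos.
set (C0 := 8 * (1 + K) ^ 2).
assert (HC0 : 0 <= C0) by (generalize (pow2_ge_0 (1 + K)); unfold C0; lra).
set (q := fun x y => weighted_slope g' (v1 x y ^ 2 + v2 x y ^ 2)).
set (sigma := fun x y => weighted_slope' g' g'' (v1 x y ^ 2 + v2 x y ^ 2)).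
assert (Hs : forall x y, 0 <= v1 x y ^ 2 + v2 x y ^ 2).
{ intros x y. generalize (pow2_ge_0 (v1 x y)) (pow2_ge_0 (v2 x y)). lra. }
assert (Ht : forall x y, euclid (v1 x y, v2 x y) = sqrt (v1 x y ^ 2 + v2 x y ^ 2)).
{ intros x y. unfold euclid, dot. simpl fst; simpl snd. f_equal. ring. }
assert (Cs : forall x y, continuity_2d_pt (fun x y => v1 x y ^ 2 + v2 x y ^ 2) x y).
{ intros x y. apply continuity_2d_pt_plus.
  - apply (continuity_1d_2d_pt_comp (fun z => z ^ 2) v1).
    + apply derivable_continuous_pt, derivable_pt_pow.
    + eapply C1_plane_continuity, H1.
  - apply (continuity_1d_2d_pt_comp (fun z => z ^ 2) v2).
    + apply derivable_continuous_pt, derivable_pt_pow.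
    + eapply C1_plane_continuity, H2. }
assert (Csig : forall x y, continuity_2d_pt sigma x y).
{ intros x y. apply (continuity_1d_2d_pt_comp (weighted_slope' g' g'')); [|apply Cs].
  apply continuity_pt_filterlim. now apply weighted_slope'_continuous. }
assert (Hq : C1_plane q (fun x y => sigma x y * (v1 x y * a x y + v2 x y * b x y))
               (fun x y => sigma x y * (v1 x y * b x y + v2 x y * c x y))).
{ assert (Cv1 := fun x y => C1_plane_continuity _ _ _ x y H1).
  assert (Cv2 := fun x y => C1_plane_continuity _ _ _ x y H2).
  destruct H1 as (D1x & D1y & Ca & Cb), H2 as (D2x & D2y & _ & Cc).
  split; [|split; [|split]]; intros x y.
  - now apply (weighted_slope_derive g' g'' (fun z => v1 z y) (fun z => v2 z y)).
  - now apply (weighted_slope_derive g' g'' (v1 x) (v2 x)).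
  - apply continuity_2d_pt_mult; [apply Csig|].
    apply continuity_2d_pt_plus; now apply continuity_2d_pt_mult.
  - apply continuity_2d_pt_mult; [apply Csig|].
    apply continuity_2d_pt_plus; now apply continuity_2d_pt_mult. }
set (density := fun x y => (2 * q x y + sigma x y * (v1 x y ^ 2 + v2 x y ^ 2))
  * (b x y ^ 2 - a x y * c x y)).
(* At a critical point [q] and the density vanish; elsewhere everything is expressed through
   [t = |grad u| > 0], in the form used by the pointwise lemmas. *)
assert (Hcases : forall x y, v1 x y ^ 2 + v2 x y ^ 2 = 0 \/
  exists t, 0 < t /\ v1 x y ^ 2 + v2 x y ^ 2 = t ^ 2 /\
    euclid (gradient u x y) = t /\ q x y = weight (t ^ 2) * g' t /\
    2 * q x y + sigma x y * (v1 x y ^ 2 + v2 x y ^ 2)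
      = 2 * (weight (t ^ 2) + t ^ 2 * weight' (t ^ 2)) * g' t + weight (t ^ 2) * t * g'' t /\
    t * g'' t * (a x y * v1 x y ^ 2 + 2 * b x y * v1 x y * v2 x y + c x y * v2 x y ^ 2)
    + g' t * (a x y * v2 x y ^ 2 - 2 * b x y * v1 x y * v2 x y + c x y * v1 x y ^ 2) = 0).
{ intros x y. destruct (Hs x y) as [Hp|Hz]; [right|now left].
  assert (Htp := sqrt_lt_R0 _ Hp).
  assert (Ht2 : v1 x y ^ 2 + v2 x y ^ 2 = sqrt (v1 x y ^ 2 + v2 x y ^ 2) ^ 2)
    by (rewrite pow2_sqrt; [reflexivity|apply Hs]).
  assert (Eq := equation_nondivergence g' g'' v1 v2 a b c x y dg' H1 H2 (Hsol x y)).
  cbv zeta in Eq. rewrite Ht in Eq. specialize (Eq Htp).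
  exists (sqrt (v1 x y ^ 2 + v2 x y ^ 2)).
  split; [exact Htp|]. split; [exact Ht2|]. split; [apply Ht|].
  unfold q, sigma, weighted_slope, weighted_slope'.
  set (t := sqrt (v1 x y ^ 2 + v2 x y ^ 2)) in *. rewrite Ht2.
  split; [reflexivity|]. split; [unfold weight; ring|exact Eq]. }
assert (Hcoef : forall t, 0 < t ->
  0 < 2 * (weight (t ^ 2) + t ^ 2 * weight' (t ^ 2)) * g' t + weight (t ^ 2) * t * g'' t).
{ intros t Htp. assert (Ht2 : 0 < t ^ 2) by now apply pow_lt.
  assert (HL := logw_ge _ (Rlt_le _ _ Ht2)).
  assert (Hk := weight_growth _ (Rlt_le _ _ Ht2)).
  assert (0 < t ^ 2 / ((1 + t ^ 2) ^ 2 * logw (t ^ 2) ^ 2)).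
  { apply Rdiv_lt_0_compat; [assumption|]. apply Rmult_lt_0_compat; apply pow_lt; lra. }
  assert (Hd := proj1 (damp_bounds _ (Rlt_le _ _ Ht2))).
  apply Rplus_lt_0_compat.
  - apply Rmult_lt_0_compat; [lra|auto].
  - apply Rmult_lt_0_compat; [|auto].
    apply Rmult_lt_0_compat; [apply Rmult_lt_0_compat|]; assumption. }
assert (Hzero : forall x y, v1 x y ^ 2 + v2 x y ^ 2 = 0 -> q x y = 0 /\ density x y = 0).
{ intros x y Hz.
  assert (Hq0 : q x y = 0) by (unfold q, weighted_slope, weight; rewrite Hz; ring).
  split; [exact Hq0|]. unfold density. rewrite Hq0, Hz. ring. }
assert (Hvan : forall x y, (x, y) <> (0, 0) -> density x y = 0).
(* The constant is that of [circulation_density_bound] with [G = M], since [g' <= M]. *)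
{ apply (circulation_vanish v1 v2 a b c q sigma (2 * M * (1 + C0))); trivial.
  - apply Rmult_lt_0_compat; lra.
  - intros x y. change (0 <= density x y).
    destruct (Hcases x y) as [Hz|(t & Htp & Hst & _ & _ & Ecoef & Eq)].
    + rewrite (proj2 (Hzero x y Hz)). lra.
    + destruct (hessian_frame _ _ _ _ _ t _ _ Htp (Hg''pos t Htp) Hst Eq) as (X & Y & _ & _ & HD).
      unfold density. rewrite Ecoef, HD.
      apply Rmult_le_pos; [left; now apply Hcoef|].
      apply Rplus_le_le_0_compat; [apply pow2_ge_0|].
      apply Rmult_le_pos; [|apply pow2_ge_0].
      left. apply Rdiv_lt_0_compat; [auto|]. apply Rmult_lt_0_compat; auto.
  - intros r p Hr x y.
    change ((q x y * (v1 x y * (b x y * - sin p + c x y * cos p)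
      - v2 x y * (a x y * - sin p + b x y * cos p))) ^ 2 <= 2 * M * (1 + C0) * density x y).
    destruct (Hcases x y) as [Hz|(t & Htp & Hst & Hgrad & Eq0 & Ecoef & Eq)].
    + destruct (Hzero x y Hz) as [-> ->]. right; ring.
    + unfold density. rewrite Ecoef, Eq0.
      assert (Hcs : (- sin p) ^ 2 + cos p ^ 2 = 1).
      { rewrite <- (sin2_cos2 p). unfold Rsqr. ring. }
      apply circulation_density_bound; auto.
      apply tangential_logw; [exact HK|lra| |].
      * rewrite <- (Rabs_pos_eq t) by lra. apply Rsqr_le_abs_0. rewrite !Rsqr_pow2, <- Hst.
        rewrite <- (Rmult_1_l (v1 x y ^ 2 + _)), <- Hcs.
        generalize (pow2_ge_0 (cos p * v1 x y + sin p * v2 x y)). lra.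
      * assert (Hxy : (x, y) <> (0, 0)).
        { intros H. injection H as Hx Hy.
          assert (Hr2 : r ^ 2 = x ^ 2 + y ^ 2).
          { rewrite <- (Rmult_1_r (r ^ 2)), <- Hcs. unfold x, y. ring. }
          rewrite Hx, Hy in Hr2. assert (0 < r ^ 2) by now apply pow_lt. lra. }
        assert (Hnorm : euclid (x, y) = r).
        { unfold euclid, dot. simpl fst; simpl snd. rewrite <- (sqrt_pow2 r) by lra. f_equal.
          rewrite <- (Rmult_1_r (r ^ 2)), <- Hcs. unfold x, y. ring. }
        assert (HT := Htan x y Hxy).
        assert (Htd : tangential_derivative u x y = - sin p * v1 x y + cos p * v2 x y).
        { unfold tangential_derivative, dot, scale, perp, gradient.
          rewrite Hnorm. simpl fst; simpl snd.
          change (v1 x y * (/ r * - y) + v2 x y * (/ r * x)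
                  = - sin p * v1 x y + cos p * v2 x y).
          unfold x at 3, y at 2. field. lra. }
        rewrite Htd, Hgrad in HT. apply Rle_trans with (1 := HT).
        apply Rmult_le_compat_r; [lra|apply Rle_abs]. }
apply (affine_of_hessian u v1 v2 a b c); trivial.
intros x y Hxy Hp.
destruct (Hcases x y) as [Hz|(t & Htp & Hst & _ & _ & Ecoef & Eq)]; [lra|].
destruct (hessian_frame _ _ _ _ _ t _ _ Htp (Hg''pos t Htp) Hst Eq) as (X & Y & HX & HY & HD).
(* The density is a positive coefficient times [X^2 + d * Y^2] with [d > 0], so [X = Y = 0]; the
   equation then gives [Z = 0]. *)
assert (HDen := Hvan x y Hxy). unfold density in HDen. rewrite Ecoef, HD in HDen.
assert (Hd : 0 < g' t / (t * g'' t)).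
{ apply Rdiv_lt_0_compat; [auto|]. apply Rmult_lt_0_compat; auto. }
assert (HX2 := pow2_ge_0 X). assert (HY2 := pow2_ge_0 Y).
apply Rmult_integral in HDen. destruct HDen as [HDen|HDen].
{ generalize (Hcoef t Htp). lra. }
assert (HdY := Rmult_le_pos _ _ (Rlt_le _ _ Hd) HY2).
assert (HX0 : X = 0) by (apply Rsqr_0_uniq; rewrite Rsqr_pow2; lra).
assert (HY0 : Y = 0).
{ apply Rsqr_0_uniq; rewrite Rsqr_pow2.
  assert (HdY0 : g' t / (t * g'' t) * Y ^ 2 = 0) by lra.
  apply Rmult_integral in HdY0. destruct HdY0; [lra|assumption]. }
rewrite HX0, Rmult_0_r in HX. rewrite HY0, Rmult_0_r in HY.
set (Z := a x y * v1 x y ^ 2 + 2 * b x y * v1 x y * v2 x y + c x y * v2 x y ^ 2) in *.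
assert (HZ : Z = 0).
{ rewrite HY, Rmult_0_r, Rplus_0_r in Eq. apply Rmult_integral in Eq.
  destruct Eq as [Eq|]; [|assumption].
  assert (0 < t * g'' t) by (apply Rmult_lt_0_compat; auto). lra. }
assert (Hs2 : 0 < (v1 x y ^ 2 + v2 x y ^ 2) ^ 2) by now apply pow_lt.
unfold Z in HZ.
(* Rotating back: each Hessian entry times [|grad u|^4] is a combination of the three vanishing
   frame forms. *)
repeat split; apply Rmult_eq_reg_r with ((v1 x y ^ 2 + v2 x y ^ 2) ^ 2);
  try lra; rewrite Rmult_0_l.
- transitivity (v1 x y ^ 2 * 0 - 2 * v1 x y * v2 x y * 0 + v2 x y ^ 2 * 0); [|ring].
  rewrite <- HZ at 1. rewrite <- HX at 1. rewrite <- HY. ring.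
- transitivity (v1 x y * v2 x y * 0 + (v1 x y ^ 2 - v2 x y ^ 2) * 0 - v1 x y * v2 x y * 0);
    [|ring].
  rewrite <- HZ at 1. rewrite <- HX at 1. rewrite <- HY. ring.
- transitivity (v2 x y ^ 2 * 0 + 2 * v1 x y * v2 x y * 0 + v1 x y ^ 2 * 0); [|ring].
  rewrite <- HZ at 1. rewrite <- HX at 1. rewrite <- HY. ring.
Qed.
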